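(* Let $d\ge2$, $D=\mathbb{R}^d\setminus\{0\}$, $V=I$ (the identity matrix), and $r=|x|=\bigl(\sum_i x_i^2\bigr)^{1/2}$. The relatively invariant priors on $D$ are exactly those of the form $p=c\,r^{\beta}$ with $c>0$ and $\beta\in\mathbb{R}$. Such a prior is admissible if and only if $\beta=2-d$; thus, up to a constant multiple, $p=r^{2-d}$ is the unique admissible relatively invariant prior.
   Context: A prior on $D$ is a function $p\in C^{2,\alpha}(D)$ (some fixed $\alpha\in(0,1]$; i.e. its second order partial derivatives are Hölder continuous with exponent $\alpha$ on compact subsets of $D$) with $p>0$ in $D$, not necessarily integrable. With $V$ a given symmetric positive definite matrix-valued function on $D$, the asymptotic risk of $p$ is the function on $D$ $$R(p)=\frac{2}{\sqrt p}\sum_{i,j}\partial_i\bigl(V_{ij}\,\partial_j\sqrt p\bigr),\qquad \partial_i=\partial/\partial x_i,$$ and $p$ is admissible if there is no prior $p^*$ on $D$, not a constant multiple of $p$, with $R(p^* )(x)\le R(p)(x)$ for all $x\in D$. A prior $p$ is relatively invariant if for every smooth one-to-one transformation $T$ of $D$ onto $D$ that changes the covariance only by a constant factor (i.e. $DT(x)\,V(x)\,DT(x)^{\top}=C\,V(Tx)$ for all $x\in D$ and some constant $C>0$, where $DT$ is the Jacobian matrix), there is a constant $c_T$ with $p(Tx)\,J(x)=c_T\,p(x)$ for all $x\in D$, where $J=|\det DT|$. For $V=I$ and $D=\mathbb{R}^d\setminus\{0\}$ these transformations are compositions of orthogonal maps and scalings. *)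

(* Defs.v *)
(* Functions on an open set D of R^d are represented by total functions on
   'rV[R]_d of which only the values on D matter: derivatives at a point of the
   open set D depend only on values in D, and functions are compared on D only. *)
From mathcomp Require Import all_boot all_order all_algebra.
From mathcomp Require Import all_classical all_reals all_analysis.

Set Implicit Arguments.
Unset Strict Implicit.
Unset Printing Implicit Defensive.

Import Order.TTheory GRing.Theory Num.Theory.
Import numFieldNormedType.Exports.

Local Open Scope classical_set_scope.
Local Open Scope ring_scope.

Section Defs.
Context {R : realType} {d : nat}.
Implicit Types (D K : set 'rV[R]_d) (f p : 'rV[R]_d -> R) (x y : 'rV[R]_d).

(* The library norm on 'rV[R]_d is the sup norm, hence this definition; both
   induce the same topology. *)
Definition euclid_norm x : R := Num.sqrt (\sum_(i < d) x 0 i ^+ 2).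

Definition basis_vec (i : 'I_d) : 'rV[R]_d := delta_mx 0 i.

Definition partial (i : 'I_d) f : 'rV[R]_d -> R := fun x => 'D_(basis_vec i) f x.

(* All partial derivatives of order at most k exist and are continuous on D. *)
Fixpoint Ck_on (k : nat) D f : Prop :=
  (forall x, D x -> {for x, continuous f}) /\
  match k with
  | 0%N => True
  | k'.+1 => forall i : 'I_d,
      (forall x, D x -> derivable f x (basis_vec i)) /\ Ck_on k' D (partial i f)
  end.

Definition holder_on (alpha : R) K f : Prop :=
  exists M : R, forall x y, K x -> K y ->
    `|f x - f y| <= M * euclid_norm (x - y) `^ alpha.

Definition C2holder (alpha : R) D f : Prop :=
  Ck_on 2 D f /\
  forall (i j : 'I_d) K, compact K -> K `<=` D ->
    holder_on alpha K (partial i (partial j f)).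

Definition prior (alpha : R) D p : Prop :=
  C2holder alpha D p /\ forall x, D x -> 0 < p x.

Definition risk (V : 'rV[R]_d -> 'M[R]_d) p : 'rV[R]_d -> R := fun x =>
  2 / Num.sqrt (p x) *
  \sum_(i < d) \sum_(j < d)
    partial i (fun y => V y i j * partial j (fun z => Num.sqrt (p z)) y) x.

Definition constant_multiple D (q p : 'rV[R]_d -> R) : Prop :=
  exists c : R, forall x, D x -> q x = c * p x.

Definition admissible (alpha : R) D (V : 'rV[R]_d -> 'M[R]_d) p : Prop :=
  prior alpha D p /\
  ~ exists q : 'rV[R]_d -> R,
      [/\ prior alpha D q, ~ constant_multiple D q p &
          forall x, D x -> risk V q x <= risk V p x].

Definition smooth_map_on D (T : 'rV[R]_d -> 'rV[R]_d) : Prop :=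
  forall (i : 'I_d) (k : nat), Ck_on k D (fun x => T x 0 i).

(* DT(x)_{ij} = d T_i / d x_j, the usual convention.  The library's [jacobian]
   acts on row vectors, and so is the transpose of this matrix. *)
Definition jacobian_mx (T : 'rV[R]_d -> 'rV[R]_d) x : 'M[R]_d :=
  \matrix_(i, j) partial j (fun y => T y 0 i) x.

Definition covariance_scaling D (V : 'rV[R]_d -> 'M[R]_d)
    (T : 'rV[R]_d -> 'rV[R]_d) : Prop :=
  [/\ smooth_map_on D T, set_bij D D T &
      exists2 C : R, 0 < C & forall x, D x ->
        jacobian_mx T x *m V x *m (jacobian_mx T x)^T = C *: V (T x)].

Definition relatively_invariant (alpha : R) D (V : 'rV[R]_d -> 'M[R]_d) p :
    Prop :=
  prior alpha D p /\
  forall T : 'rV[R]_d -> 'rV[R]_d, covariance_scaling D V T ->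
    exists cT : R, forall x, D x ->
      p (T x) * `|\det (jacobian_mx T x)| = cT * p x.

Definition punctured_space : set 'rV[R]_d := [set x | x != 0].

Definition identity_cov : 'rV[R]_d -> 'M[R]_d := fun=> 1%:M.

Definition power_form (c beta : R) p : Prop :=
  forall x, punctured_space x -> p x = c * euclid_norm x `^ beta.

End Defs.

(* Main.v *)
(** A prior is studied through [w = sqrt q * |x|^((d-2)/2)].  With this substitution,
    [R(q) <= R(|x|^(2-d))] says that [w > 0] satisfies
    [Lap w + (2-d) x . grad w / |x|^2 <= 0].  In the variables [ln |x|] and [x / |x|] this
    operator is, up to a positive factor, the Laplacian of the cylinder [R x S^(d-1)], on which
    positive superharmonic functions are constant: comparison with [A + B ln |x|] on annuli
    shows that [w] is minimal at a point of the unit sphere, and the strong minimum principle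
    concludes.  For other exponents [b] the risk of [|x|^b] exceeds that of [|x|^(2-d)] by
    [(b + d - 2)^2 / (2 |x|^2)].  A map with [DT DT^T = C I] has zero second derivatives, so it
    is linear and [|Tx|^2 = C |x|^2]; conversely invariance under reflections makes a prior
    radial, and invariance under dilations makes it a power of [|x|]. *)
Require Import Defs.
From mathcomp Require Import all_boot all_order all_algebra.
From mathcomp Require Import all_classical all_reals all_analysis.
From mathcomp Require Import ring lra.

Set Implicit Arguments.
Unset Strict Implicit.
Unset Printing Implicit Defensive.

Import Order.TTheory GRing.Theory Num.Theory.
Import numFieldNormedType.Exports.

Local Open Scope classical_set_scope.
Local Open Scope ring_scope.

(** * Calculus along lines *)

(** For [v = sqrt q] the comparison with [|x|^(2-d)] reads [Lap v + ((d-2)/2)^2 v / |x|^2 <= 0],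
    with the critical Hardy constant. At that constant the two radial exponents coincide, and the
    radial solutions are [|x|^((2-d)/2) (A + B ln |x|)]. The logarithm changes sign, so only the
    pure power survives among positive ones. Nothing is known of [w] near [0] or infinity except
    positivity. This is enough because [ln |x|] is unbounded at both ends: an arbitrarily small
    multiple of it pushes a comparison function below [0] far out. The second derivative test at a
    minimum gives only a weak inequality, so each comparison function must be a strict subsolution.
    This is the reason for the added linear term on annuli and for the choice of the rate in Hopf's
    barrier. The test is applied along one coordinate axis at a time, so the analysis rests on
    one-variable calculus along lines. *)

Section LineCalculus.
Context {R : realType} {V : normedModType R}.
Implicit Types (f g : V -> R) (x y v : V) (t : R).

(** Both difference quotients are the same function of the increment. This carries one-variable
    theorems over to derivatives along [v]. *)
Lemma is_derive_line f x v t (df : R) :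
  is_derive (t *: v + x) v f df <-> is_derive t 1 (fun h => f (h *: v + x)) df.
Proof.
suff e : (fun h : R => h^-1 *: ((f \o shift (t *: v + x)) (h *: v) -
    f (t *: v + x))) =
  (fun h : R => h^-1 *: (((fun h => f (h *: v + x)) \o shift t) (h *: (1 : R)) -
    f (t *: v + x))).
  by split=> -[]; rewrite /derivable /derive => a b; split; rewrite /derivable /derive;
    [rewrite -e|rewrite -e|rewrite e|rewrite e].
by apply/funext => h /=; rewrite scalerDl addrA [h *: (1 : R)]mulr1.
Qed.

Lemma is_derive_translate f x a v (df : R) :
  is_derive (x + a) v f df -> is_derive x v (fun y => f (y + a)) df.
Proof.
suff e : (fun h : R => h^-1 *: ((f \o shift (x + a)) (h *: v) -
    f (x + a))) =
  (fun h : R => h^-1 *: (((fun y => f (y + a)) \o shift x) (h *: v) -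
    f (x + a))).
  by case; rewrite /derivable /derive e => ? ?; split.
by apply/funext => h /=; rewrite addrA.
Qed.

Lemma is_derive_comp f (g : R -> R) x v (df dg : R) :
  is_derive x v f df -> is_derive (f x) 1 g dg ->
  is_derive x v (fun y => g (f y)) (dg * df).
Proof.
have x0 : x = 0 *: v + x by rewrite scale0r add0r.
move=> fx gfx; rewrite [in X in is_derive X]x0; apply/is_derive_line.
apply: (@is_derive1_comp _ g (fun h => f (h *: v + x))).
  by rewrite -x0.
by apply/is_derive_line; rewrite -x0.
Qed.

(** The endpoints come in either order because it is applied to increments of unknown sign. *)
Lemma MVT_line f (df : V -> R) x v (a b : R) :
  (forall t, Num.min a b <= t <= Num.max a b ->
     is_derive (t *: v + x) v f (df (t *: v + x))) ->
  exists2 c, Num.min a b <= c <= Num.max a b &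
    f (b *: v + x) - f (a *: v + x) = df (c *: v + x) * (b - a).
Proof.
wlog ab : a b / a <= b => [H|].
  have [/H//|ba] : a <= b \/ b <= a by apply/orP; exact: le_total.
  rewrite minC maxC => /(H _ _ ba)[c cab e]; exists c => //.
  by rewrite -[LHS]opprB e -mulrN opprB.
rewrite (min_l ab) (max_r ab) => fd.
have fd' t : t \in `[a, b] -> is_derive t 1 (fun h => f (h *: v + x))
    (df (t *: v + x)).
  by rewrite in_itv/= => /fd /is_derive_line.
have fd1 t : t \in `]a, b[ -> is_derive t 1 (fun h => f (h *: v + x))
    (df (t *: v + x)).
  by move=> tab; apply: fd'; exact: subset_itv_oo_cc tab.
have fc : {within `[a, b], continuous (fun h => f (h *: v + x))}.
  by apply: derivable_within_continuous => t /fd' [].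
have [c cab e] := @MVT_segment R _ (fun t => df (t *: v + x)) _ _ ab fd1 fc.
by exists c => //; rewrite in_itv/= in cab.
Qed.

Lemma is_derive_add f g x v (df dg : R) :
  is_derive x v f df -> is_derive x v g dg ->
  is_derive x v (fun y => f y + g y) (df + dg).
Proof. by move=> ? ?; exact: is_deriveD. Qed.

Lemma is_derive_mul f g x v (df dg : R) :
  is_derive x v f df -> is_derive x v g dg ->
  is_derive x v (fun y => f y * g y) (df * g x + f x * dg).
Proof.
by move=> ? ?; apply: is_derive_eq; rewrite addrC mulrC.
Qed.

Lemma is_derive_sumf n (f : 'I_n -> V -> R) x v (df : 'I_n -> R) :
  (forall i, is_derive x v (f i) (df i)) ->
  is_derive x v (fun y => \sum_(i < n) f i y) (\sum_(i < n) df i).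
Proof.
move=> H; rewrite (_ : (fun _ => _) = \sum_(i < n) f i); last first.
  by apply/funext => y; rewrite fct_sumE.
exact: is_derive_sum.
Qed.

Lemma is_derive_unique f x v (df dg : R) :
  is_derive x v f df -> is_derive x v f dg -> df = dg.
Proof. by move=> [_ <-] [_ <-]. Qed.

(** If [l < 0], the mean value theorem just after [0] would produce a value below the minimum. Only
    the derivative of [df] at [x] itself enters, so no Taylor expansion is required. *)
Lemma is_derive_at_min f (df : V -> R) x v e (l : R) : 0 < e ->
  (forall t, - e < t < e -> is_derive (t *: v + x) v f (df (t *: v + x))) ->
  is_derive x v df l ->
  (forall t, - e < t < e -> f x <= f (t *: v + x)) ->
  df x = 0 /\ 0 <= l.
Proof.
move=> e0 fd dfd fmin.
have x0 : x = 0 *: v + x by rewrite scale0r add0r.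
have z0 : - e < 0 < e by rewrite oppr_lt0 e0.
have df0 : df x = 0.
  have d0 := @derive1_at_min R (fun h => f (h *: v + x)) (- e) e 0.
  apply: (@is_derive_unique f x v); first by rewrite [in X in is_derive X]x0 [in df x]x0; apply: fd.
  rewrite [in X in is_derive X]x0; apply/is_derive_line; apply: d0.
  - by rewrite ge0_cp // ltW.
  - by move=> t; rewrite in_itv/= => /fd /is_derive_line[].
  - by rewrite in_itv.
  - by move=> t; rewrite in_itv/= -x0; exact: fmin.
split=> //; rewrite leNgt; apply/negP => l0.
(* the derivative of [f] is negative just after [0], so [f] decreases there *)
have /is_derive_line dfd0 : is_derive (0 *: v + x) v df l by rewrite -x0.
case: dfd0 => dfc dfl.
have : \forall h \near 0^'+, h^-1 * (df (h *: v + x) - df x) < 0.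
  have dfcr : (fun h => h^-1 * (df (h *: v + x) - df x)) @ 0^'+ --> l.
    have : (fun h => h^-1 * (df (h *: v + x) - df x)) @ 0^' --> l.
      move: dfc; rewrite /derivable -dfl /derive.
      rewrite (_ : (fun h : R => _) = (fun h => h^-1 * (df (h *: v + x) - df x)))//.
      by apply/funext => h /=; rewrite addr0 scale0r add0r [h *: (1 : R)]mulr1.
    apply: cvg_trans; apply: cvg_app => A [r r0 Ar]; exists r => // h hr h0.
    by apply: Ar => //; exact: lt0r_neq0.
  exact: (cvgr_lt _ dfcr).
move=> [r /= r0 Hr].
pose h := Num.min r e / 2.
have h0 : 0 < h by rewrite divr_gt0 // lt_min r0.
have hm : h < Num.min r e.
  by rewrite /h ltr_pdivrMr // mulrDr mulr1 ltrDl lt_min r0.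
have [hr he] : h < r /\ h < e by move: hm; rewrite lt_min => /andP.
have fd1 t : 0 <= t <= h -> is_derive t 1 (fun h => f (h *: v + x))
    (df (t *: v + x)).
  move=> /andP[t0 th]; apply/is_derive_line/fd.
  by rewrite (le_lt_trans th he) andbT (lt_le_trans _ t0) // oppr_lt0.
have fd2 t : t \in `]0, h[ -> is_derive t 1 (fun h => f (h *: v + x))
    (df (t *: v + x)).
  by rewrite in_itv /= => /andP[t0 th]; apply: fd1; rewrite !ltW.
have fc : {within `[0, h], continuous (fun h => f (h *: v + x))}.
  by apply: derivable_within_continuous => t; rewrite in_itv/= => /fd1 [].
have [c] := @MVT R _ (fun t => df (t *: v + x)) _ _ h0 fd2 fc.
rewrite in_itv/= scale0r add0r subr0 => /andP[c0 ch] fe.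
have := fmin h; rewrite he (@lt_trans _ _ 0) ?oppr_lt0// => /(_ isT).
rewrite -subr_ge0 fe pmulr_lge0 // leNgt => /negP; apply.
have /Hr : ball 0 r c by rewrite /ball/= sub0r normrN gtr0_norm // (lt_trans ch).
by move=> /(_ c0); rewrite df0 subr0 pmulr_rlt0 ?invr_gt0.
Qed.

End LineCalculus.

(** * Euclidean geometry of the punctured space *)

Section EuclideanGeometry.
Context {R : realType} {d : nat}.
Implicit Types (x y z : 'rV[R]_d) (a : R).

Definition dot x y : R := \sum_(i < d) x 0 i * y 0 i.

Definition sqn x : R := \sum_(i < d) x 0 i ^+ 2.

Lemma dotxx x : dot x x = sqn x. Proof. by []. Qed.

Lemma dotC x y : dot x y = dot y x.
Proof. by apply: eq_bigr => i _; rewrite mulrC. Qed.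

Lemma dotDl x y z : dot (x + y) z = dot x z + dot y z.
Proof. by rewrite -big_split; apply: eq_bigr => i _; rewrite mxE mulrDl. Qed.

Lemma dotDr x y z : dot z (x + y) = dot z x + dot z y.
Proof. by rewrite dotC dotDl ![dot z _]dotC. Qed.

Lemma dotZl a x y : dot (a *: x) y = a * dot x y.
Proof. by rewrite mulr_sumr; apply: eq_bigr => i _; rewrite mxE mulrA. Qed.

Lemma dotZr a x y : dot x (a *: y) = a * dot x y.
Proof. by rewrite dotC dotZl dotC. Qed.

Lemma dotNl x y : dot (- x) y = - dot x y.
Proof. by rewrite -scaleN1r dotZl mulN1r. Qed.

Lemma dotNr x y : dot x (- y) = - dot x y.
Proof. by rewrite dotC dotNl dotC. Qed.

Lemma sqnD x y : sqn (x + y) = sqn x + 2 * dot x y + sqn y.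
Proof. by rewrite -!dotxx dotDl !dotDr [dot y x]dotC; ring. Qed.

Lemma sqnN x : sqn (- x) = sqn x.
Proof. by rewrite -!dotxx dotNl dotNr opprK. Qed.

Lemma sqnB x y : sqn (x - y) = sqn x - 2 * dot x y + sqn y.
Proof. by rewrite sqnD dotNr sqnN mulrN. Qed.

Lemma sqnZ a x : sqn (a *: x) = a ^+ 2 * sqn x.
Proof. by rewrite -!dotxx dotZl dotZr mulrA. Qed.

Lemma sqn_ge0 x : 0 <= sqn x.
Proof. by apply: sumr_ge0 => i _; exact: sqr_ge0. Qed.

Lemma sqn0 : sqn 0 = 0.
Proof. by rewrite /sqn big1 // => i _; rewrite mxE expr0n. Qed.

Lemma le_sqn x (i : 'I_d) : x 0 i ^+ 2 <= sqn x.
Proof.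
rewrite /sqn (bigD1 i) //= lerDl; apply: sumr_ge0 => j _; exact: sqr_ge0.
Qed.

Lemma sqn_eq0 x : (sqn x == 0) = (x == 0).
Proof.
apply/eqP/eqP => [x0|->]; last exact: sqn0.
apply/rowP => i; rewrite mxE; apply/eqP; rewrite -sqrf_eq0 eq_le sqr_ge0 andbT.
by rewrite -x0 le_sqn.
Qed.

Lemma sqn_gt0 x : (0 < sqn x) = (x != 0).
Proof. by rewrite lt_def sqn_eq0 sqn_ge0 andbT. Qed.

Lemma sqn_basis_vec (i : 'I_d) : sqn (basis_vec i : 'rV[R]_d) = 1.
Proof.
rewrite /sqn (bigD1 i) //= big1 => [|j /negbTE ji].
  by rewrite mxE !eqxx expr1n addr0.
by rewrite mxE ji andbF expr0n.
Qed.

Lemma near_neq0 x y : sqn (x - y) < sqn y -> x != 0.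
Proof. by apply: contraTneq => ->; rewrite sub0r sqnN ltxx. Qed.

Lemma exists_orthogonal x : (2 <= d)%N -> x != 0 ->
  exists2 v, v != 0 & dot v x = 0.
Proof.
move=> d2 x0.
have /rV0Pn [i xi] := x0.
have [j ji] : exists j : 'I_d, j != i.
  have d1 : (1 < d)%N by [].
  case: (eqVneq i (Ordinal d1)) => [->|ne].
    by exists (Ordinal (ltnW d1)).
  by exists (Ordinal d1); rewrite eq_sym.
exists (x 0 j *: basis_vec i - x 0 i *: basis_vec j).
  apply/eqP => /rowP /(_ j); rewrite !mxE eqxx (negbTE ji) !eqxx /=.
  by rewrite mulr0 add0r mulr1 => /eqP; rewrite oppr_eq0 (negbTE xi).
have dotb k : dot (basis_vec k) x = x 0 k.
  rewrite /dot (bigD1 k) //= big1 ?addr0 => [|l /negbTE lk]; rewrite !mxE.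
    by rewrite !eqxx mul1r.
  by rewrite lk andbF mul0r.
by rewrite dotDl dotNl !dotZl !dotb mulrC subrr.
Qed.

(* Such a [P] spreads from [y] to the union of the balls B(t y, t|y|), t > 0, which is the
   half-space dot z y > 0, and three half-spaces reach any point. *)
Lemma ball_propagation (P : 'rV[R]_d -> Prop) : (2 <= d)%N ->
  (forall y z, y != 0 -> P y -> sqn (z - y) < sqn y -> P z) ->
  forall y z, y != 0 -> z != 0 -> P y -> P z.
Proof.
move=> d2 Pball.
(* The point [3/2 u] is at distance [|u| / 2] from [u], hence in the ball allowed by [Pball]. *)
have Pscale y n : y != 0 -> P y -> P ((3 / 2) ^+ n *: y).
  move=> y0; elim: n => [|n IH] Py; first by rewrite expr0 scale1r.
  have yn : (3 / 2) ^+ n *: y != 0.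
    by rewrite scaler_eq0 negb_or y0 andbT expf_neq0.
  apply: (Pball ((3 / 2) ^+ n *: y)) => //; first exact: IH.
  set u := _ *: y in yn *; rewrite exprS -scalerA -/u.
  have -> : (3 / 2) *: u - u = (1 / 2) *: u.
    by rewrite -{2}[u]scale1r -scalerBl; congr (_ *: _); field.
  by rewrite sqnZ; move: yn; rewrite -sqn_gt0; move: (sqn u) => a a0; lra.
have Phalf y z : y != 0 -> P y -> 0 < dot z y -> P z.
  move=> y0 Py zy.
  (* The ball of radius [t |y|] around [t y] contains [z] iff [|z|^2 < 2 t <z, y>], so a large [t]
     is enough. The bound [n <= 2 (3/2)^n] gives one among the powers of [3/2]. *)
  have [n hn] : exists n, sqn z < (3 / 2) ^+ n * (2 * dot z y).
    have := archi_boundP (@divr_ge0 _ (sqn z) (dot z y) (sqn_ge0 z) (ltW zy)).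
    set n := Num.bound _; rewrite ltr_pdivrMr // => hn; exists n.
    rewrite (lt_le_trans hn) // mulrA ler_pM2r //.
    elim: (n) => [|m IH]; first by rewrite expr0 mul1r ler0n.
    have : 1 <= (3 / 2 : R) ^+ m by rewrite exprn_ege1 //; lra.
    move: IH; rewrite exprS -[m.+1%:R]natr1; move: (_ ^+ m) m%:R => p q; lra.
  apply: (Pball ((3 / 2) ^+ n *: y)).
  - by rewrite scaler_eq0 negb_or y0 andbT expf_neq0.
  - exact: Pscale.
  - by rewrite sqnB dotZr; move: hn; move: (_ ^+ n) => p; lra.
have Porth y z : y != 0 -> P y -> z != 0 -> dot z y = 0 -> P z.
  move=> y0 Py z0 zy.
  have yz : P (y + z).
    by apply: (Phalf y) => //; rewrite dotDl zy addr0 dotxx sqn_gt0.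
  apply: (Phalf (y + z)) => //; last by rewrite dotDr zy add0r dotxx sqn_gt0.
  by rewrite -sqn_gt0 sqnD dotC zy mulr0 addr0 ltr_wpDr ?sqn_ge0 // sqn_gt0.
move=> y z y0 z0 Py.
have [zy|zy|/Porth] := ltrgt0P (dot z y); last exact.
  exact: (Phalf y).
(* When [z] points away from [y], the route turns through an orthogonal [v] to [- y]. In dimension
   one the two half-lines would stay separate. *)
have [v v0 vy] := exists_orthogonal d2 y0.
have Pv : P v by apply: (Porth y).
have PNy : P (- y) by apply: (Porth v); rewrite ?oppr_eq0 // dotNl dotC vy oppr0.
by apply: (Phalf (- y)); rewrite ?oppr_eq0 // dotNr oppr_gt0.
Qed.

Lemma between0_sqr (a t : R) :
  Num.min 0 a <= t <= Num.max 0 a -> t ^+ 2 <= a ^+ 2.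
Proof.
have [a0|a0] := leP 0 a => /andP[t0 ta]; first by rewrite ler_sqr.
by rewrite -sqrrN -[leRHS]sqrrN ler_sqr ?nnegrE ?oppr_ge0 ?lerN2 // ltW.
Qed.

(** Inside the ball of radius [|y|] around [y], change the coordinates of [y] into those of [z] one
    at a time. No coordinate ever differs from that of [y] by more than [z] does, so the path stays
    in the ball and misses [0]. Propagation over balls does the rest, the punctured space not being
    convex. *)
Lemma zero_partials_constant (f : 'rV[R]_d -> R) : (2 <= d)%N ->
  (forall x i, x != 0 -> is_derive x (basis_vec i) f 0) ->
  forall x y, x != 0 -> y != 0 -> f x = f y.
Proof.
move=> d2 f0 x y x0 y0.
apply: (@ball_propagation (fun z => f x = f z) d2 _ x y) => // {}y {}z {}y0 fxy zy.
pose u n : 'rV[R]_d := \row_i (if (i < n)%N then z 0 i else y 0 i).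
suff H n : (n <= d)%N -> f (u n) = f y.
  rewrite fxy -(H d) //; congr f; apply/rowP => i; by rewrite mxE ltn_ord.
elim: n => [_|n IH nd].
  by congr f; apply/rowP => i; rewrite mxE.
apply: etrans (IH (ltnW nd)); pose i := Ordinal nd.
have ui t : t ^+ 2 <= (z 0 i - y 0 i) ^+ 2 -> t *: basis_vec i + u n != 0.
  move=> t1; apply: (@near_neq0 _ y); apply: le_lt_trans zy.
  apply: ler_sum => j _; rewrite !mxE eqxx /=.
  have [->|ji] := eqVneq j i; first by rewrite ltnn mulr1 addrK.
  by rewrite mulr0 add0r; case: ifP => // _; rewrite subrr expr0n sqr_ge0.
have -> : u n.+1 = (z 0 i - y 0 i) *: basis_vec i + u n.
  apply/rowP => j; rewrite !mxE eqxx /=.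
  have [->|ji] := eqVneq j i; first by rewrite ltnS leqnn ltnn mulr1 subrK.
  rewrite mulr0 add0r ltnS leq_eqVlt [nat_of_ord j == n](_ : _ = false) //.
  by apply/negP => /eqP jn; move/negP: ji; apply; apply/eqP/val_inj.
have [|c _] := @MVT_line R _ f (fun=> 0) (u n) (basis_vec i) 0 (z 0 i - y 0 i).
  by move=> t tz; apply: f0; apply: ui; exact: between0_sqr.
by rewrite scale0r add0r mul0r => /eqP; rewrite subr_eq0 => /eqP.
Qed.

End EuclideanGeometry.

(** * Partial derivatives *)

Section PartialDerivatives.
Context {R : realType} {d : nat}.
Implicit Types (D : set 'rV[R]_d) (x y z : 'rV[R]_d) (f g : 'rV[R]_d -> R).

Lemma is_derive_coord x v (j : 'I_d) :
  is_derive x v (fun y : 'rV[R]_d => y 0 j) (v 0 j).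
Proof.
rewrite -[x in X in is_derive X]add0r -(scale0r v); apply/is_derive_line.
rewrite (_ : (fun h : R => _) = (fun h => h * v 0 j + x 0 j)); last first.
  by apply/funext => h; rewrite !mxE.
have h1 := @is_derive_mul R R id (cst (v 0 j)) 0 1 _ _ (is_derive_id _ _)
  (is_derive_cst _ _ _).
apply: is_derive_eq (is_derive_add h1 (is_derive_cst (x 0 j) _ _)) _.
by rewrite mul1r mulr0 !addr0.
Qed.

Lemma partialE f x i (df : R) : is_derive x (basis_vec i) f df ->
  partial i f x = df.
Proof. by case. Qed.

Lemma near_open D x : open D -> D x -> \forall y \near x, D y.
Proof. by move=> oD Dx; apply: open_nbhs_nbhs. Qed.

Lemma eq_open_partial D f g i x : open D -> D x ->
  (forall y, D y -> f y = g y) -> partial i f x = partial i g x.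
Proof.
move=> oD Dx fg; apply: near_eq_derive.
by apply: filterS (near_open oD Dx) => y /fg.
Qed.

Lemma eq_open_is_derive D f g v x (df : R) : open D -> D x ->
  (forall y, D y -> f y = g y) -> is_derive x v f df -> is_derive x v g df.
Proof.
move=> oD Dx fg; apply: near_eq_is_derive; near=> y.
by apply: fg; near: y; exact: near_open oD Dx.
Unshelve. all: by end_near.
Qed.

Lemma eq_open_continuous D f g x : open D -> D x ->
  (forall y, D y -> f y = g y) -> {for x, continuous f} -> {for x, continuous g}.
Proof.
move=> oD Dx fg; rewrite /prop_for /continuous_at -(fg x Dx) => fc.
have e : \forall y \near x, f y = g y.
  by apply: filterS (near_open oD Dx) => y /fg.
by apply: cvg_trans fc; exact: near_eq_cvg e.
Qed.

Lemma eq_Ck_on k D f g : open D -> (forall x, D x -> f x = g x) ->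
  Ck_on k D f -> Ck_on k D g.
Proof.
elim: k f g => [|k IH] f g oD fg [fc fk].
  split=> // x Dx; exact: (eq_open_continuous oD Dx fg (fc _ Dx)).
split=> [x Dx|i]; first exact: (eq_open_continuous oD Dx fg (fc _ Dx)).
have [fd fck] := fk i; split=> [x Dx|].
  by have /derivableP/(eq_open_is_derive oD Dx fg)[] := fd x Dx.
by apply: IH fck => // x Dx; exact: eq_open_partial fg.
Qed.

Lemma Ck_onS_is_derive k D f (df : 'I_d -> 'rV[R]_d -> R) : open D ->
  (forall x, D x -> {for x, continuous f}) ->
  (forall i x, D x -> is_derive x (basis_vec i) f (df i x)) ->
  (forall i, Ck_on k D (df i)) -> Ck_on k.+1 D f.
Proof.
move=> oD fc fd fk; split=> // i; split=> [x /(fd i)[]//|].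
by apply: eq_Ck_on (fk i) => // x /(fd i)/partialE.
Qed.

Lemma Ck_on_is_derive k D f i x : Ck_on k.+1 D f -> D x ->
  is_derive x (basis_vec i) f (partial i f x).
Proof. by move=> [_ /(_ i)[fd _]] /fd /derivableP. Qed.

Lemma Ck_on_partial k D f i : Ck_on k.+1 D f -> Ck_on k D (partial i f).
Proof. by move=> [_ /(_ i)[]]. Qed.

Lemma Ck_on_continuous k D f x : Ck_on k D f -> D x -> {for x, continuous f}.
Proof. by case: k => [|k] [fc _] /fc. Qed.

Lemma Ck_on_cst k D (c : R) : open D -> Ck_on k D (cst c).
Proof.
elim: k c => [|k IH] c oD; first by split=> // x _; exact: cst_continuous.
split=> [x _|i]; first exact: cst_continuous.
rewrite (_ : partial i (cst c) = cst 0); first by split=> [x _|]; [exact: derivable_cst|exact: IH].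
by apply/funext => x; apply: partialE; exact: is_derive_cst.
Qed.

(** The mean value theorem is applied along [u] to [f (y + h v) - f y], then along [v] to [fu]. *)
Lemma second_difference D f (fu fuv : 'rV[R]_d -> R) u v x (h : R) :
  (forall y, D y -> is_derive y u f (fu y)) ->
  (forall y, D y -> is_derive y v fu (fuv y)) -> 0 <= h ->
  (forall s t : R, 0 <= s <= h -> 0 <= t <= h -> D (s *: u + x + t *: v)) ->
  exists s t, [/\ 0 <= s <= h, 0 <= t <= h &
    f (h *: u + x + h *: v) - f (h *: u + x) - (f (x + h *: v) - f x) =
    fuv (s *: u + x + t *: v) * h * h].
Proof.
move=> fuD fuvD h0 HD.
have h0m := min_l h0; have h0M := max_r h0.
have HD0 (s : R) : 0 <= s <= h -> D (s *: u + x).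
  by move=> sh; have := HD s 0 sh; rewrite lexx h0 scale0r addr0; apply.
have [s|s] := @MVT_line R 'rV[R]_d (fun y => f (y + h *: v) - f y)
  (fun y => fu (y + h *: v) - fu y) x u 0 h.
  rewrite h0m h0M => sh; apply: is_deriveB; last exact: fuD (HD0 _ sh).
  by apply: is_derive_translate; apply: fuD; apply: HD => //; rewrite h0 lexx.
rewrite h0m h0M scale0r add0r subr0 => sh ->.
have [t|t] := @MVT_line R 'rV[R]_d fu fuv (s *: u + x) v 0 h.
  by rewrite h0m h0M => th; apply: fuvD; rewrite addrC; exact: HD.
rewrite h0m h0M scale0r add0r subr0 => th e2; exists s, t.
split; [exact: sh|exact: th|congr (_ * _)].
by rewrite (addrC (s *: u + x)) e2 (addrC (s *: u + x)).
Qed.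

(** Schwarz's theorem: one second difference over a small parallelogram equals [h^2 fuv] at one
    nearby point and [h^2 fvu] at another, and both are continuous at [x]. *)
Lemma mixed_derivatives_eq D f (fu fv fuv fvu : 'rV[R]_d -> R) u v x :
  open D -> D x ->
  (forall y, D y -> is_derive y u f (fu y)) ->
  (forall y, D y -> is_derive y v f (fv y)) ->
  (forall y, D y -> is_derive y v fu (fuv y)) ->
  (forall y, D y -> is_derive y u fv (fvu y)) ->
  {for x, continuous fuv} -> {for x, continuous fvu} -> fuv x = fvu x.
Proof.
move=> oD Dx fuD fvD fuvD fvuD fuvc fvuc.
apply/eqP; rewrite -subr_eq0 -normr_le0.
apply/ler_addgt0Pr => e e0; rewrite add0r.
have e2 : 0 < e / 2 by rewrite divr_gt0.
have : \forall y \near x,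
    [/\ D y, `|fuv x - fuv y| < e / 2 & `|fvu x - fvu y| < e / 2].
  have h1 : \forall y \near x, `|fuv x - fuv y| < e / 2.
    exact: (cvgr_dist_lt fuv _ fuvc _ e2).
  have h2 : \forall y \near x, `|fvu x - fvu y| < e / 2.
    exact: (cvgr_dist_lt fvu _ fvuc _ e2).
  by apply: filterS3 (near_open oD Dx) h1 h2 => y Dy h1y h2y; exact: And3.
move=> /nbhs_ballP[r /= r0 Hr].
(* Small enough for the whole parallelogram to lie in the ball of radius [r]; the summand [1] keeps
   the denominator positive when [u] and [v] vanish. *)
pose h := r / (3 * (1 + `|u| + `|v|)).
have uv0 : 0 < 1 + `|u| + `|v| by rewrite -addrA ltr_wpDr // addr_ge0.
have h0 : 0 < h by rewrite divr_gt0 // mulr_gt0.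
have Hb u' v' (s t : R) : `|u'| + `|v'| = `|u| + `|v| ->
    0 <= s <= h -> 0 <= t <= h -> ball x r (s *: u' + x + t *: v').
  move=> uv' /andP[s0 sh] /andP[t0 th]; rewrite -ball_normE /=.
  have -> : x - (s *: u' + x + t *: v') = - (s *: u' + t *: v').
    by rewrite addrAC [_ + x]addrC opprD addNKr.
  rewrite normrN; apply: le_lt_trans (ler_normD _ _) _.
  rewrite !normrZ !ger0_norm //.
  have : s * `|u'| <= h * `|u'| by rewrite ler_wpM2r.
  have : t * `|v'| <= h * `|v'| by rewrite ler_wpM2r.
  have : h * (3 * (1 + `|u| + `|v|)) = r by rewrite /h divfK // gt_eqF // mulr_gt0.
  have : h * (`|u'| + `|v'|) = h * (`|u| + `|v|) by rewrite uv'.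
  have : 0 <= h * `|u| by rewrite mulr_ge0 // ltW.
  have : 0 <= h * `|v| by rewrite mulr_ge0 // ltW.
  clearbody h; lra.
have Hc1 s t sh th := Hr _ (Hb u v s t erefl sh th).
have Hc2 s t sh th := Hr _ (Hb v u s t (addrC _ _) sh th).
have [s [t [sh th e1]]] := second_difference fuD fuvD (ltW h0)
  (fun s t sh th => let: And3 Dy _ _ := Hc1 s t sh th in Dy).
have [s' [t' [sh' th' e3]]] := second_difference fvD fvuD (ltW h0)
  (fun s t sh th => let: And3 Dy _ _ := Hc2 s t sh th in Dy).
have [_ c1 _] := Hc1 s t sh th; have [_ _ c2] := Hc2 s' t' sh' th'.
move: c1 c2.
(* The second difference is symmetric in [u] and [v], so the two expressions for it agree and [h^2]
   cancels. *)
have -> : fvu (s' *: v + x + t' *: u) = fuv (s *: u + x + t *: v).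
  have hh : h * h != 0 by rewrite mulf_neq0 // gt_eqF.
  apply: (mulIf hh); rewrite [LHS]mulrA [RHS]mulrA.
  apply: (etrans (esym e3)); apply: etrans e1.
  rewrite (_ : h *: v + x + h *: u = h *: u + x + h *: v); last first.
    by rewrite addrAC [RHS]addrAC [h *: v + h *: u]addrC.
  by rewrite [h *: u + x]addrC [h *: v + x]addrC; ring.
move: (fuv (_ + _)) => m.
rewrite !ltr_distl ler_distl => /andP[? ?] /andP[? ?]; apply/andP; split; lra.
Qed.

Lemma partial_comm D f i j x : open D -> Ck_on 2 D f -> D x ->
  partial i (partial j f) x = partial j (partial i f) x.
Proof.
move=> oD f2 Dx.
have f1 k y (Dy : D y) := Ck_on_is_derive k f2 Dy.
have fc k l := Ck_on_continuous (Ck_on_partial k (Ck_on_partial l f2)) Dx.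
have f11 k l y (Dy : D y) := Ck_on_is_derive k (Ck_on_partial l f2) Dy.
exact: (mixed_derivatives_eq oD Dx (f1 j) (f1 i) (f11 i j) (f11 j i) (fc i j)
  (fc j i)).
Qed.

End PartialDerivatives.

(** * Maps scaling the covariance *)

Section ScalingMaps.
Context {R : realType} {d : nat}.
Implicit Types (x y z : 'rV[R]_d) (A : 'M[R]_d).

Lemma open_punctured_space : open (@punctured_space R d).
Proof.
rewrite (_ : punctured_space = ~` [set 0]).
  by rewrite openC; exact/accessible_closed_set1/hausdorff_accessible/norm_hausdorff.
by apply/seteqP; split=> x /eqP.
Qed.

Lemma continuous_sumf (T : topologicalType) n (f : 'I_n -> T -> R) (u : T) :
  (forall i, {for u, continuous (f i)}) ->
  {for u, continuous (fun v => \sum_(i < n) f i v)}.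
Proof.
move=> fc; have -> : (fun v => \sum_(i < n) f i v) = \sum_(i < n) f i.
  by apply/funext => v; rewrite fct_sumE.
elim/big_ind : _ => [|g h gc hc|i _]; [exact: cst_continuous| |exact: fc].
exact: continuousD.
Qed.

Lemma mulmx_row_entry x A i : (x *m A^T) 0 i = \sum_(k < d) A i k * x 0 k.
Proof. by rewrite mxE; apply: eq_bigr => k _; rewrite mxE mulrC. Qed.

Lemma is_derive_linear_form (a : 'I_d -> R) x j :
  is_derive x (basis_vec j) (fun y : 'rV[R]_d => \sum_(k < d) a k * y 0 k) (a j).
Proof.
apply: is_derive_eq.
  apply: is_derive_sumf => k.
  exact: is_derive_mul (is_derive_cst (a k) _ _) (is_derive_coord _ _ k).
rewrite (bigD1 j) //= big1 => [|k /negbTE kj]; rewrite !mxE mul0r add0r.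
  by rewrite !eqxx mulr1 addr0.
by rewrite kj andbF mulr0.
Qed.

Lemma continuous_linear_form (a : 'I_d -> R) :
  continuous (fun y : 'rV[R]_d => \sum_(k < d) a k * y 0 k).
Proof.
move=> x; apply: continuous_sumf => k; apply: continuousM.
  exact: cst_continuous.
exact: coord_continuous.
Qed.

(** Points are row vectors, so the linear map with matrix [A] is multiplication by [A^T] on the
    right. *)
Lemma jacobian_linear A x : jacobian_mx (fun y => y *m A^T) x = A.
Proof.
apply/matrixP => i j; rewrite mxE; apply: partialE.
rewrite (_ : (fun y => _) = (fun y : 'rV_d => \sum_(k < d) A i k * y 0 k)).
  exact: is_derive_linear_form.
by apply/funext => y; exact: mulmx_row_entry.
Qed.

Lemma conformal_mul_trC A (C : R) : C != 0 -> A *m A^T = C%:M -> A^T *m A = C%:M.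
Proof.
move=> C0 AA; have /mulmx1C : A *m (C^-1 *: A^T) = 1%:M.
  by rewrite -scalemxAr AA scale_scalar_mx mulVf.
rewrite -scalemxAl => /(congr1 ( *:%R C)).
by rewrite scalerA divff // scale1r scale_scalar_mx mulr1.
Qed.

Lemma sqn_mulmx x : sqn x = (x *m x^T) 0 0.
Proof. by rewrite mxE; apply: eq_bigr => i _; rewrite mxE expr2. Qed.

Lemma sqn_conformal A (C : R) x : C != 0 -> A *m A^T = C%:M ->
  sqn (x *m A^T) = C * sqn x.
Proof.
move=> C0 /(conformal_mul_trC C0) AA.
rewrite !sqn_mulmx trmx_mul trmxK mulmxA -(mulmxA x) AA mul_mx_scalar.
by rewrite -scalemxAl mxE.
Qed.

Lemma covariance_scaling_linear A (C : R) : 0 < C -> A *m A^T = C%:M ->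
  covariance_scaling punctured_space identity_cov (fun x => x *m A^T).
Proof.
move=> C0 AA; have Cn0 : C != 0 by rewrite gt_eqF.
have AA' := conformal_mul_trC Cn0 AA.
split; last first.
- by exists C => // x _; rewrite jacobian_linear mulmx1 AA scalemx1.
- split=> [x|x y _ _ xy|y].
  + by rewrite /punctured_space /= -!sqn_gt0 (sqn_conformal _ Cn0 AA) pmulr_rgt0.
  + have : x *m A^T *m A = y *m A^T *m A by rewrite xy.
    by rewrite -!mulmxA AA' !mul_mx_scalar; exact: scalerI.
  + move=> y0; have yA : (C^-1 *: (y *m A)) *m A^T = y.
      by rewrite -scalemxAl -mulmxA AA mul_mx_scalar scalerA mulVf // scale1r.
    exists (C^-1 *: (y *m A)) => //.
    by apply: contraPneq y0 => e; rewrite -yA e mul0mx /punctured_space /= eqxx.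
- move=> i k.
  rewrite (_ : (fun y => _) = (fun y : 'rV_d => \sum_(k < d) A i k * y 0 k)).
    case: k => [|k]; first by split=> // x _; exact: continuous_linear_form.
    apply: (@Ck_onS_is_derive _ _ _ _ _ (fun j => cst (A i j))).
    + exact: open_punctured_space.
    + by move=> x _; exact: continuous_linear_form.
    + by move=> j x _; exact: is_derive_linear_form.
    + by move=> j; apply: Ck_on_cst; exact: open_punctured_space.
  by apply/funext => y; exact: mulmx_row_entry.
Qed.

(* The argument by which a metric determines its Christoffel symbols. *)
Lemma symmetric_antisymmetric_eq0 (I : Type) (G : I -> I -> I -> R) :
  (forall m k l, G m k l = G k m l) -> (forall m k l, G m k l = - G m l k) ->
  forall m k l, G m k l = 0.
Proof.
move=> Gs Ga m k l; have : G m k l = - G m k l.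
  by rewrite [LHS]Ga [G m l k]Gs [G l m k]Ga opprK [LHS]Gs [G k l m]Ga Gs.
lra.
Qed.

(** Here [p i k] and [q i k m] stand for the first and second partials of the [i]-th component. As
    [C] is constant, differentiating the orthogonality of the columns makes [G m k l], the product
    of a second-derivative vector with a column, antisymmetric in [k] and [l]; equality of mixed
    partials makes it symmetric in [m] and [k]. So [G] vanishes, and the columns span the space. *)
Lemma conformal_second_derivative0 (p : 'I_d -> 'I_d -> 'rV[R]_d -> R)
    (q : 'I_d -> 'I_d -> 'I_d -> 'rV[R]_d -> R) (C : R) : C != 0 ->
  (forall i k m x, x != 0 -> is_derive x (basis_vec m) (p i k) (q i k m x)) ->
  (forall i k m x, x != 0 -> q i k m x = q i m k x) ->
  (forall k l x, x != 0 -> \sum_i p i k x * p i l x = (C%:M : 'M[R]_d) k l) ->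
  forall i k m x, x != 0 -> q i k m x = 0.
Proof.
move=> C0 pq qs pp i k m x x0.
pose G m k l := \sum_i q i k m x * p i l x.
have Gs m' k' l' : G m' k' l' = G k' m' l'.
  by apply: eq_bigr => j _; rewrite qs.
have Ga m' k' l' : G m' k' l' = - G m' l' k'.
  apply/eqP; rewrite -subr_eq0 opprK -big_split /=; apply/eqP.
  have dpp : is_derive x (basis_vec m') (fun y => \sum_i p i k' y * p i l' y)
      (\sum_i (q i k' m' x * p i l' x + p i k' x * q i l' m' x)).
    by apply: is_derive_sumf => j; apply: is_derive_mul; exact: pq.
  have dcst := is_derive_cst ((C%:M : 'M[R]_d) k' l') x (basis_vec m').
  have := is_derive_unique (eq_open_is_derive open_punctured_space x0 (pp k' l') dpp) dcst.
  by apply: etrans; apply: eq_bigr => j _; rewrite [p j k' x * _]mulrC.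
have G0 := symmetric_antisymmetric_eq0 Gs Ga.
pose P : 'M[R]_d := \matrix_(j, l) p j l x.
have PP : P^T *m P^T^T = C%:M.
  apply/matrixP => a b; rewrite -(pp a b x x0) mxE.
  by apply: eq_bigr => j _; rewrite !mxE.
have := conformal_mul_trC C0 PP; rewrite trmxK => PP'.
have : (\row_j q j k m x) *m P *m P^T = 0.
  rewrite (_ : _ *m P = 0) ?mul0mx //; apply/rowP => l; rewrite mxE [RHS]mxE.
  by apply: etrans (G0 m k l); apply: eq_bigr => j _; rewrite !mxE.
rewrite -mulmxA PP' mul_mx_scalar => /rowP /(_ i); rewrite !mxE => /eqP.
by rewrite mulf_eq0 (negbTE C0) => /eqP.
Qed.

Lemma covariance_scalingP (T : 'rV[R]_d -> 'rV[R]_d) : (2 <= d)%N ->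
  covariance_scaling punctured_space identity_cov T ->
  exists A C, [/\ 0 < C, A *m A^T = C%:M &
    forall x, x != 0 -> jacobian_mx T x = A /\ T x = x *m A^T].
Proof.
move=> d2 [Tsm [Tfun _ Tsurj] [C C0 HC]].
have Cn0 : C != 0 by rewrite gt_eqF.
have JJ x : x != 0 -> jacobian_mx T x *m (jacobian_mx T x)^T = C%:M.
  by move=> /HC; rewrite mulmx1 scalemx1.
have JJ' x (x0 : x != 0) := conformal_mul_trC Cn0 (JJ x x0).
pose t i := fun x => T x 0 i.
have oD := open_punctured_space.
have tD i k x : x != 0 -> is_derive x (basis_vec k) (t i) (partial k (t i) x).
  exact: (Ck_on_is_derive k (Tsm i 1%N)).
have pD i k m x : x != 0 -> is_derive x (basis_vec m) (partial k (t i))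
    (partial m (partial k (t i)) x).
  exact: (Ck_on_is_derive m (Ck_on_partial k (Tsm i 2%N))).
have pC i k m x : x != 0 ->
    partial m (partial k (t i)) x = partial k (partial m (t i)) x.
  by move=> x0; exact: (partial_comm m k oD (Tsm i 2%N) x0).
have orth k l x : x != 0 ->
    \sum_i partial k (t i) x * partial l (t i) x = (C%:M : 'M[R]_d) k l.
  by move=> /JJ' <-; rewrite mxE; apply: eq_bigr => i _; rewrite !mxE.
have q0 := conformal_second_derivative0 Cn0 pD pC orth.
have p_cst i k : forall x y, x != 0 -> y != 0 -> partial k (t i) x = partial k (t i) y.
  apply: zero_partials_constant => // x m x0.
  by rewrite -(q0 i k m x x0); exact: pD.
pose e : 'rV[R]_d := const_mx 1.
have e0 : e != 0.
  by apply/eqP => /rowP /(_ (Ordinal (ltnW d2))); rewrite !mxE => /eqP; rewrite oner_eq0.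
pose A := jacobian_mx T e; have AA : A *m A^T = C%:M by exact: JJ.
have TA i : forall x y, x != 0 -> y != 0 ->
    t i x + - \sum_(k < d) A i k * x 0 k = t i y + - \sum_(k < d) A i k * y 0 k.
  apply: zero_partials_constant => // x k x0; apply: is_derive_eq.
    apply: is_derive_add; first exact: tD.
    apply: is_deriveN; exact: is_derive_linear_form.
  by rewrite mxE (p_cst i k x e) // subrr.
pose b := T e - e *m A^T.
have TE x : x != 0 -> T x = x *m A^T + b.
  move=> x0; apply/rowP => i; have := TA i x e x0 e0.
  rewrite -!mulmx_row_entry /t => /eqP; rewrite subr_eq => /eqP ->.
  by rewrite addrC [RHS]mxE; congr (_ + _); rewrite !mxE.
(* A nonzero [b] would be [T x] for some nonzero [x], by surjectivity; then [x *m A^T = 0], which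
   contradicts [|x A^T|^2 = C |x|^2]. *)
have b0 : b = 0.
  apply/eqP/negP => /negP b0; have [x x0 Tx] := Tsurj b b0.
  have xA : x *m A^T = 0 by apply: (addIr b); rewrite -TE // add0r.
  have := sqn_conformal x Cn0 AA; rewrite xA sqn0 => /esym/eqP.
  by rewrite mulf_eq0 (negbTE Cn0) sqn_eq0 (negbTE x0).
exists A, C; split=> // x x0; split; last by rewrite TE // b0 addr0.
by apply/matrixP => i k; rewrite !mxE; exact: p_cst.
Qed.

End ScalingMaps.

(** * Powers of the norm *)

Section PowersOfTheNorm.
Context {R : realType} {d : nat}.
Implicit Types (x y z : 'rV[R]_d) (a c g : R).

Lemma is_derive_sqnB y x (i : 'I_d) :
  is_derive x (basis_vec i) (fun z => sqn (z - y)) (2 * (x 0 i - y 0 i)).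
Proof.
rewrite /sqn.
have dc k := is_derive_add (is_derive_coord x (basis_vec i) k)
  (is_derive_cst (- y 0 k) x (basis_vec i)).
have ds := is_derive_sumf (fun k => is_derive_mul (dc k) (dc k)).
rewrite (_ : (fun z => _) =
    (fun z : 'rV_d => \sum_k (z 0 k + - y 0 k) * (z 0 k + - y 0 k))); last first.
  by apply/funext => z; apply: eq_bigr => k _; rewrite !mxE expr2.
apply: is_derive_eq ds _.
rewrite (bigD1 i) //= big1 => [|k /negbTE ki]; rewrite !mxE.
  by rewrite !eqxx /= mulr1n; ring.
by rewrite ki andbF /= mulr0n; ring.
Qed.

Lemma is_derive_sqn x (i : 'I_d) :
  is_derive x (basis_vec i) (@sqn R d) (2 * x 0 i).
Proof.
have := is_derive_sqnB 0 x i; rewrite mxE subr0.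
by rewrite (_ : (fun z => _) = @sqn R d) //; apply/funext => z; rewrite subr0.
Qed.

Lemma continuous_sqnB y : continuous (fun z => sqn (z - y)).
Proof.
move=> x; rewrite /sqn; apply: continuous_sumf => k.
rewrite (_ : (fun z => _) =
  (fun z : 'rV_d => (z 0 k - y 0 k) * (z 0 k - y 0 k))); last first.
  by apply/funext => z; rewrite !mxE expr2.
have h : {for x, continuous (fun z : 'rV_d => z 0 k - y 0 k)}.
  by apply: continuousB; [exact: coord_continuous|exact: cst_continuous].
exact: continuousM.
Qed.

Lemma continuous_sqn : continuous (@sqn R d).
Proof.
rewrite (_ : @sqn R d = fun z => sqn (z - 0)); first exact: continuous_sqnB.
by apply/funext => z; rewrite subr0.
Qed.

(** This is [|x|^(2g)]: with the polynomial [|x|^2] as base, each derivative is a coordinate times a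
    function of the same family. *)
Definition sqnpow g x : R := sqn x `^ g.

Lemma sqnpow_gt0 g x : x != 0 -> 0 < sqnpow g x.
Proof. by move=> x0; rewrite powR_gt0 // sqn_gt0. Qed.

Lemma euclid_norm_powR x (b : R) : euclid_norm x `^ b = sqnpow (b / 2) x.
Proof.
rewrite /euclid_norm -powR12_sqrt; last exact: sqn_ge0.
by rewrite -powRrM mulrC.
Qed.

Lemma sqnpowB1 g x : x != 0 -> sqnpow (g - 1) x = sqnpow g x / sqn x.
Proof.
move=> x0; rewrite /sqnpow powRB; last by rewrite sqn_eq0 x0 implybT.
by rewrite powRr1 // sqn_ge0.
Qed.

Lemma sqnpowD g g' x : x != 0 -> sqnpow (g + g') x = sqnpow g x * sqnpow g' x.
Proof. by move=> x0; rewrite /sqnpow powRD // sqn_eq0 x0 implybT. Qed.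

Lemma is_derive_sqnpow g x (i : 'I_d) : x != 0 ->
  is_derive x (basis_vec i) (sqnpow g) (2 * g * (x 0 i * sqnpow (g - 1) x)).
Proof.
move=> x0; have s0 : 0 < sqn x by rewrite sqn_gt0.
apply: is_derive_eq.
  exact: is_derive_comp (is_derive_sqn x i) (is_derive1_powR g s0).
by rewrite /sqnpow; ring.
Qed.

Lemma continuous_sqnpow g x : x != 0 -> {for x, continuous (sqnpow g)}.
Proof.
move=> x0; have s0 : 0 < sqn x by rewrite sqn_gt0.
apply: (@continuous_comp _ _ _ (@sqn R d) (fun t => t `^ g)).
  exact: continuous_sqn.
have [h _] := is_derive1_powR g s0.
exact/differentiable_continuous/derivable1_diffP.
Qed.

Lemma continuous_coord_sqnpow g (i : 'I_d) x : x != 0 ->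
  {for x, continuous (fun y => y 0 i * sqnpow g y)}.
Proof.
move=> x0; apply: continuousM; first exact: coord_continuous.
exact: continuous_sqnpow.
Qed.

Definition dcoord_sqnpow g (i j : 'I_d) x : R :=
  (i == j)%:R * sqnpow g x + x 0 i * (2 * g * (x 0 j * sqnpow (g - 1) x)).

Lemma is_derive_coord_sqnpow g (i j : 'I_d) x : x != 0 ->
  is_derive x (basis_vec j) (fun y => y 0 i * sqnpow g y) (dcoord_sqnpow g i j x).
Proof.
move=> x0; apply: is_derive_eq.
  exact: is_derive_mul (is_derive_coord _ _ _) (is_derive_sqnpow g j x0).
by rewrite /dcoord_sqnpow mxE eqxx.
Qed.

Lemma continuous_dcoord_sqnpow g (i j : 'I_d) x : x != 0 ->
  {for x, continuous (dcoord_sqnpow g i j)}.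
Proof.
move=> x0; apply: continuousD.
  apply: continuousM; [exact: cst_continuous|exact: continuous_sqnpow].
apply: continuousM; first exact: coord_continuous.
apply: continuousM; first exact: cst_continuous.
exact: continuous_coord_sqnpow.
Qed.

(** The divergence of the vector field [x |x|^(2g)], from which Laplacians of powers are read
    off. *)
Lemma sum_dcoord_sqnpow g x : x != 0 ->
  \sum_i dcoord_sqnpow g i i x = (d%:R + 2 * g) * sqnpow g x.
Proof.
move=> x0; rewrite big_split /= (eq_bigr (fun=> sqnpow g x)); last first.
  by move=> i _; rewrite eqxx mul1r.
rewrite sumr_const card_ord -mulr_natl.
rewrite (eq_bigr (fun i => x 0 i ^+ 2 * (2 * g * sqnpow (g - 1) x))); last first.
  by move=> i _; ring.
rewrite -mulr_suml -/(sqn x) sqnpowB1 //.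
by field; rewrite sqn_eq0.
Qed.

Lemma scaled_is_derive (f : 'rV[R]_d -> R) c x v (df : R) :
  is_derive x v f df -> is_derive x v (fun y => c * f y) (c * df).
Proof.
move=> fx; apply: is_derive_eq (is_derive_mul (is_derive_cst c x v) fx) _.
by rewrite mul0r add0r.
Qed.

Lemma scaled_continuous (f : 'rV[R]_d -> R) c x :
  {for x, continuous f} -> {for x, continuous (fun y => c * f y)}.
Proof. by move=> fx; apply: continuousM fx; exact: cst_continuous. Qed.

(** Each off-diagonal term differentiates the zero function. Formulas for the derivatives valid away
    from [0] suffice, since the punctured space is open. *)
Lemma risk_identity_cov (p v : 'rV[R]_d -> R) (g h : 'I_d -> 'rV[R]_d -> R) x :
  (forall y, y != 0 -> Num.sqrt (p y) = v y) ->
  (forall i y, y != 0 -> is_derive y (basis_vec i) v (g i y)) ->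
  (forall i y, y != 0 -> is_derive y (basis_vec i) (g i) (h i y)) ->
  x != 0 -> risk identity_cov p x = 2 / v x * \sum_i h i x.
Proof.
move=> pv vg gh x0; have oD := @open_punctured_space R d.
rewrite /risk pv //; congr (_ * _); apply: eq_bigr => i _.
rewrite (bigD1 i) //= big1 ?addr0 => [|j ji].
  apply: partialE; apply: (eq_open_is_derive oD x0 _ (gh i x x0)) => y y0.
  rewrite mxE eqxx mul1r; apply/esym/partialE.
  by apply: (eq_open_is_derive oD y0 _ (vg i y y0)) => z z0; rewrite pv.
rewrite (_ : (fun y => _) = cst 0); last first.
  by apply/funext => y; rewrite mxE eq_sym (negbTE ji) mul0r.
by apply: partialE; exact: is_derive_cst.
Qed.

Lemma risk_power_form (c b : R) (p : 'rV[R]_d -> R) x : 0 < c ->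
  power_form c b p -> x != 0 ->
  risk identity_cov p x = b * (d%:R + b / 2 - 2) / sqn x.
Proof.
(* The exponent is halved once for the square root and once because [sqnpow] has base [|x|^2]. *)
move=> c0 pE x0; pose g := b / 4.
have sc0 : 0 < Num.sqrt c by rewrite sqrtr_gt0.
pose v y := Num.sqrt c * sqnpow g y.
pose dv (i : 'I_d) y := Num.sqrt c * (2 * g * (y 0 i * sqnpow (g - 1) y)).
pose ddv (i : 'I_d) y := Num.sqrt c * (2 * g * dcoord_sqnpow (g - 1) i i y).
have pv y : y != 0 -> Num.sqrt (p y) = v y.
  move=> y0; rewrite pE // euclid_norm_powR sqrtrM ?ltW //.
  congr (_ * _); rewrite -powR12_sqrt ?powR_ge0 // /sqnpow -powRrM.
  by congr (_ `^ _); rewrite /g; field.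
have vD i y : y != 0 -> is_derive y (basis_vec i) v (dv i y).
  by move=> y0; apply: scaled_is_derive; exact: is_derive_sqnpow.
have dvD i y : y != 0 -> is_derive y (basis_vec i) (dv i) (ddv i y).
  by move=> y0; do 2 apply: scaled_is_derive; exact: is_derive_coord_sqnpow.
apply: etrans (risk_identity_cov pv vD dvD x0) _.
rewrite -mulr_sumr -mulr_sumr sum_dcoord_sqnpow // sqnpowB1 // /v /g.
have := sqnpow_gt0 (b / 4) x0; move: (sqnpow _ _) => P P0.
by field; rewrite sqn_eq0 x0 /= !gt_eqF.
Qed.

Lemma Ck_on_scaled_sqnpow c g : Ck_on 2 punctured_space (fun y => c * sqnpow g y).
Proof.
have oD := @open_punctured_space R d.
apply: (@Ck_onS_is_derive _ _ _ _ _ (fun i y => c * (2 * g * (y 0 i * sqnpow (g - 1) y)))) => //.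
- by move=> x x0; apply: scaled_continuous; exact: continuous_sqnpow.
- by move=> i x x0; apply: scaled_is_derive; exact: is_derive_sqnpow.
move=> i.
apply: (@Ck_onS_is_derive _ _ _ _ _ (fun j y => c * (2 * g * dcoord_sqnpow (g - 1) i j y))) => //.
- by move=> x x0; do 2 apply: scaled_continuous; exact: continuous_coord_sqnpow.
- by move=> j x x0; do 2 apply: scaled_is_derive; exact: is_derive_coord_sqnpow.
move=> j; split=> // x x0.
by do 2 apply: scaled_continuous; exact: continuous_dcoord_sqnpow.
Qed.

End PowersOfTheNorm.

(** * Power forms are priors *)

Section HolderOnCompacts.
Context {R : realType} {d : nat}.
Implicit Types (x y z : 'rV[R]_d) (a c g : R) (f : 'rV[R]_d -> R).
Implicit Types K : set 'rV[R]_d.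

(** The bound is carried along so that the class is closed under products. *)
Definition bounded_lipschitz K f : Prop :=
  exists B M : R, (forall x, K x -> `|f x| <= B) /\
    forall x y, K x -> K y -> `|f x - f y| <= M * euclid_norm (x - y).

Lemma bounded_lipschitz_cst K c : bounded_lipschitz K (fun=> c).
Proof.
by exists `|c|, 0; split=> // x y _ _; rewrite subrr normr0 mul0r.
Qed.

Lemma bounded_lipschitzD K f f' : bounded_lipschitz K f ->
  bounded_lipschitz K f' -> bounded_lipschitz K (fun x => f x + f' x).
Proof.
move=> [B [M [fB fM]]] [B' [M' [fB' fM']]]; exists (B + B'), (M + M'); split.
  by move=> x Kx; apply: le_trans (ler_normD _ _) _; apply: lerD; auto.
move=> x y Kx Ky; rewrite opprD addrACA mulrDl.
by apply: le_trans (ler_normD _ _) _; apply: lerD; auto.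
Qed.

Lemma bounded_lipschitzM K f f' : bounded_lipschitz K f ->
  bounded_lipschitz K f' -> bounded_lipschitz K (fun x => f x * f' x).
Proof.
move=> [B [M [fB fM]]] [B' [M' [fB' fM']]].
exists (B * B'), (B * M' + B' * M); split.
  by move=> x Kx; rewrite normrM ler_pM //; auto.
move=> x y Kx Ky.
have -> : f x * f' x - f y * f' y = f x * (f' x - f' y) + f' y * (f x - f y).
  by ring.
apply: le_trans (ler_normD _ _) _; rewrite mulrDl -!mulrA !normrM.
by apply: lerD; apply: ler_pM => //; auto.
Qed.

Lemma bounded_lipschitz_sum K n (f : 'I_n -> 'rV[R]_d -> R) :
  (forall i, bounded_lipschitz K (f i)) ->
  bounded_lipschitz K (fun x => \sum_i f i x).
Proof.
move=> fK; have -> : (fun x => \sum_i f i x) = \sum_i f i.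
  by apply/funext => x; rewrite fct_sumE.
elim/big_ind : _ => [|h h' hK h'K|i _]; [exact: bounded_lipschitz_cst| |exact: fK].
exact: bounded_lipschitzD.
Qed.

Lemma euclid_norm_ge0 x : 0 <= euclid_norm x.
Proof. exact: sqrtr_ge0. Qed.

Lemma coord_le_euclid_norm x (i : 'I_d) : `|x 0 i| <= euclid_norm x.
Proof. by rewrite -sqrtr_sqr ler_sqrt ?sqn_ge0 // le_sqn. Qed.

Lemma coord_le_norm x (i : 'I_d) : `|x 0 i| <= `|x|.
Proof.
rewrite [leRHS]/Num.norm /= mx_normrE.
exact: (le_bigmax _ (fun ij : 'I_1 * 'I_d => `|x ij.1 ij.2|) (0, i)).
Qed.

Lemma bounded_lipschitz_coord K (i : 'I_d) : compact K ->
  bounded_lipschitz K (fun x => x 0 i).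
Proof.
move=> /compact_bounded [M [_ /(_ (M + 1))]]; rewrite ltrDl => /(_ ltr01) HM.
exists (M + 1), 1; split=> [x Kx|x y _ _].
  by apply: le_trans (HM x Kx); exact: coord_le_norm.
by rewrite mul1r; have := coord_le_euclid_norm (x - y) i; rewrite !mxE.
Qed.

Lemma bounded_lipschitz_sqn K : compact K -> bounded_lipschitz K (@sqn R d).
Proof.
by move=> cK; apply: bounded_lipschitz_sum => i;
  apply: bounded_lipschitzM; exact: bounded_lipschitz_coord.
Qed.

(** The power is increasing or decreasing according to the sign of [g]; the sum of the end values
    dominates in both cases. *)
Lemma powR_between (a b t g : R) : 0 < a -> a <= t <= b ->
  t `^ g <= a `^ g + b `^ g.
Proof.
move=> a0 /andP[at_ tb]; have t0 := lt_le_trans a0 at_.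
have [g0|g0] := leP 0 g.
  rewrite (@le_trans _ _ (b `^ g)) ?lerDr ?powR_ge0 //.
  by rewrite ge0_ler_powR // nnegrE ltW // (lt_le_trans t0).
rewrite (@le_trans _ _ (a `^ g)) ?lerDl ?powR_ge0 //.
rewrite -[g]opprK ![_ `^ (- - g)]powRN lef_pV2 ?posrE ?powR_gt0 //.
by rewrite ge0_ler_powR ?nnegrE ?oppr_ge0 // ltW.
Qed.

Lemma powR_lipschitz (a b g t u : R) : 0 < a -> a <= t <= b -> a <= u <= b ->
  `|t `^ g - u `^ g| <= `|g| * (a `^ (g - 1) + b `^ (g - 1)) * `|t - u|.
Proof.
move=> a0 /andP[at_ tb] /andP[au ub].
have [s|s] := @MVT_line R R (fun s => s `^ g) (fun s => g * s `^ (g - 1)) 0 1 u t.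
  rewrite ge_min le_max addr0 [s *: _]mulr1 => /andP[us _].
  apply: is_derive1_powR; case/orP: us => [us|ts].
    exact: lt_le_trans a0 (le_trans au us).
  exact: lt_le_trans a0 (le_trans at_ ts).
rewrite !addr0 ![_ *: (1 : R)]mulr1 ge_min le_max => /andP[us su] ->.
rewrite !normrM -!mulrA ler_wpM2l // ler_wpM2r //.
rewrite ger0_norm ?powR_ge0 //; apply: powR_between => //.
apply/andP; split.
  by case/orP: us => [/(le_trans au)|/(le_trans at_)].
by case/orP: su => h; apply: le_trans h _.
Qed.

(** On [K] the values of [|x|^2] lie in an interval away from [0]. The mean value theorem is used on
    that interval, which avoids any convexity of [K]. *)
Lemma bounded_lipschitz_sqnpow K g : compact K -> K `<=` punctured_space ->
  bounded_lipschitz K (sqnpow g).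
Proof.
move=> cK KD; have [K0|K0] := pselect (K !=set0); last first.
  by exists 0, 0; split=> [x Kx|x y Kx]; exfalso; apply: K0; exists x.
have cs : {within K, continuous (@sqn R d)}.
  by apply: continuous_subspaceT; exact: continuous_sqn.
have [xm] := EVT_min_rV K0 cK cs; rewrite inE => Kxm xmin.
have [xM] := EVT_max_rV K0 cK cs; rewrite inE => KxM xmax.
have a0 : 0 < sqn xm by rewrite sqn_gt0; exact: KD.
have ab x : K x -> sqn xm <= sqn x <= sqn xM.
  by move=> Kx; rewrite xmin ?xmax // inE.
have [B [M [_ HM]]] := bounded_lipschitz_sqn cK.
exists (sqn xm `^ g + sqn xM `^ g),
  (`|g| * (sqn xm `^ (g - 1) + sqn xM `^ (g - 1)) * M); split=> [x Kx|x y Kx Ky].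
  by rewrite ger0_norm ?powR_ge0 //; apply: powR_between => //; exact: ab.
apply: le_trans (powR_lipschitz g a0 (ab x Kx) (ab y Ky)) _.
rewrite -[leRHS]mulrA ler_wpM2l ?HM // mulr_ge0 //.
by rewrite addr_ge0 // powR_ge0.
Qed.

(** Split a distance [n] as [n^(1-alpha) n^alpha] and bound the first factor by a power of the
    diameter. *)
Lemma bounded_lipschitz_holder K f alpha : compact K -> 0 < alpha -> alpha <= 1 ->
  bounded_lipschitz K f -> holder_on alpha K f.
Proof.
move=> cK a0 a1 [B [M [_ fM]]].
have [S [_ [sS _]]] := bounded_lipschitz_sqn cK.
(* By the parallelogram law [|x - y|^2 <= 2 |x|^2 + 2 |y|^2 <= 4 S]. *)
pose L := Num.sqrt (4 * S).
exists (`|M| * L `^ (1 - alpha)) => x y Kx Ky.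
have nL : euclid_norm (x - y) <= L.
  apply: ler_wsqrtr; rewrite -/(sqn (x - y)); have := sS x Kx; have := sS y Ky.
  rewrite !ger0_norm ?sqn_ge0 // => hx hy.
  have : 0 <= sqn (x + y) by exact: sqn_ge0.
  by rewrite sqnB sqnD; lra.
apply: le_trans (fM x y Kx Ky) _.
set n := euclid_norm (x - y) in nL *.
have n0 : 0 <= n := euclid_norm_ge0 _.
have en : n = n `^ (1 - alpha) * n `^ alpha.
  rewrite -powRD ?subrK ?powRr1 //.
  by rewrite oner_eq0.
rewrite {1}en mulrA; apply: ler_wpM2r; first exact: powR_ge0.
apply: (@le_trans _ _ (`|M| * n `^ (1 - alpha))).
  by rewrite ler_wpM2r ?powR_ge0 // ler_norm.
rewrite ler_wpM2l // ge0_ler_powR ?nnegrE ?subr_ge0 //.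
exact: sqrtr_ge0.
Qed.

Lemma eq_holder_on K f f' alpha : (forall x, K x -> f x = f' x) ->
  holder_on alpha K f -> holder_on alpha K f'.
Proof.
by move=> ff' [M fM]; exists M => x y Kx Ky; rewrite -!ff' //; exact: fM.
Qed.

Lemma eq_prior (p q : 'rV[R]_d -> R) alpha :
  (forall x, x != 0 -> p x = q x) ->
  prior alpha punctured_space p -> prior alpha punctured_space q.
Proof.
have oD := @open_punctured_space R d.
move=> pq [[p2 pH] p0]; split; last by move=> x x0; rewrite -pq //; exact: p0.
split; first exact: (eq_Ck_on oD pq p2).
move=> i j K cK KD; apply: eq_holder_on (pH i j K cK KD) => x /KD x0.
by apply: (eq_open_partial _ oD x0) => y y0; exact: (eq_open_partial _ oD y0 pq).
Qed.

Lemma prior_power_form (p : 'rV[R]_d -> R) (alpha c b : R) :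
  0 < alpha -> alpha <= 1 -> 0 < c -> power_form c b p ->
  prior alpha punctured_space p.
Proof.
move=> a0 a1 c0 pE; have oD := @open_punctured_space R d.
apply: (@eq_prior (fun y => c * sqnpow (b / 2) y)).
  by move=> x x0; rewrite pE // euclid_norm_powR.
split; last by move=> x x0; rewrite mulr_gt0 // sqnpow_gt0.
split; first exact: Ck_on_scaled_sqnpow.
move=> i j K cK KD; set g := b / 2.
apply: (@eq_holder_on _ (fun y => c * (2 * g * dcoord_sqnpow (g - 1) j i y))).
  move=> x /KD x0; apply/esym/partialE.
  apply: (@eq_open_is_derive _ _ _
    (fun y => c * (2 * g * (y 0 j * sqnpow (g - 1) y))) _ _ _ _ oD x0).
    by move=> y y0; apply/esym/partialE; apply: scaled_is_derive; exact: is_derive_sqnpow.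
  by do 2 apply: scaled_is_derive; exact: is_derive_coord_sqnpow.
apply: bounded_lipschitz_holder => //.
have H h := bounded_lipschitz_sqnpow h cK KD.
have Hc k := @bounded_lipschitz_coord K k cK.
have H0 a := bounded_lipschitz_cst K a.
do 2 (apply: bounded_lipschitzM; first exact: H0).
apply: bounded_lipschitzD; first exact: bounded_lipschitzM.
apply: bounded_lipschitzM; first exact: Hc.
apply: bounded_lipschitzM; first exact: H0.
exact: bounded_lipschitzM.
Qed.

End HolderOnCompacts.

(** * Minimum principles *)

Section MinimumPrinciples.
Context {R : realType} {d : nat}.
Implicit Types (x y z : 'rV[R]_d) (f w : 'rV[R]_d -> R).
Implicit Types g h : 'I_d -> 'rV[R]_d -> R.

(** Mixed partials are left out: the Laplacian and the test at a minimum involve only the pure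
    ones. *)
Definition second_partials f g h : Prop := forall i x, x != 0 ->
  is_derive x (basis_vec i) f (g i x) /\ is_derive x (basis_vec i) (g i) (h i x).

(* The operator Laplacian + (2 - d) x . grad / |x|^2, applied to a function with gradient [g]
   and pure second derivatives [h]. *)
Definition drift_laplacian g h x : R :=
  \sum_i h i x + (2 - d%:R) * (\sum_i x 0 i * g i x) / sqn x.

Lemma second_partialsB f g h f' g' h' : second_partials f g h ->
  second_partials f' g' h' ->
  second_partials (fun x => f x - f' x) (fun i x => g i x - g' i x)
    (fun i x => h i x - h' i x).
Proof.
move=> H H' i x x0; have [? ?] := H i x x0; have [? ?] := H' i x x0.
by split; exact: is_deriveB.
Qed.

Lemma drift_laplacianB g h g' h' x :
  drift_laplacian (fun i x => g i x - g' i x) (fun i x => h i x - h' i x) x =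
  drift_laplacian g h x - drift_laplacian g' h' x.
Proof.
rewrite /drift_laplacian sumrB.
have -> : \sum_i x 0 i * (g i x - g' i x) =
    \sum_i x 0 i * g i x - \sum_i x 0 i * g' i x.
  by rewrite -sumrB; apply: eq_bigr => i _; rewrite mulrBr.
by ring.
Qed.

Lemma interior_segment (K : set 'rV[R]_d) x v : K^° x ->
  exists2 e : R, 0 < e & forall t, - e < t < e -> K (t *: v + x).
Proof.
move=> /nbhs_ballP[r /= r0 Kr]; have v0 : 0 < 1 + `|v| by rewrite ltr_pwDl.
exists (r / (1 + `|v|)); first exact: divr_gt0.
move=> t; rewrite -ltr_norml => tr; apply: Kr; rewrite -ball_normE /=.
rewrite opprD addrCA subrr addr0 normrN normrZ.
apply: (@le_lt_trans _ _ (`|t| * (1 + `|v|))); last by rewrite -ltr_pdivlMr.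
by rewrite ler_wpM2l // lerDr.
Qed.

(** At an interior minimum the gradient vanishes and the pure second derivatives are nonnegative, so
    the operator cannot be negative there. Hence the minimum sits where [f] is already known to be
    nonnegative. *)
Lemma weak_minimum_principle (K : set 'rV[R]_d) f g h :
  compact K -> K `<=` punctured_space ->
  (forall x, x != 0 -> {for x, continuous f}) -> second_partials f g h ->
  (forall x, K x -> 0 <= f x \/ K^° x /\ drift_laplacian g h x < 0) ->
  forall x, K x -> 0 <= f x.
Proof.
move=> cK KD fc fgh Kf x Kx.
have fcK : {within K, continuous f}.
  by apply: continuous_in_subspaceT => y; rewrite inE => /KD/fc.
have [xm] := EVT_min_rV (ex_intro _ x Kx) cK fcK.
rewrite inE => Kxm xmin; apply: (@le_trans _ _ (f xm)); last first.
  by apply: xmin; rewrite inE.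
have [//|[Kxmi]] := Kf xm Kxm; rewrite ltNge => /negP []; have xm0 := KD _ Kxm.
have gh i : g i xm = 0 /\ 0 <= h i xm.
  have [e e0 Ke] := interior_segment (basis_vec i) Kxmi.
  apply: (@is_derive_at_min R _ f (g i) xm (basis_vec i) e) => //.
  - by move=> t /Ke/KD tx; case: (fgh i _ tx).
  - by case: (fgh i _ xm0).
  - by move=> t /Ke Kt; apply: xmin; rewrite inE.
rewrite /drift_laplacian.
have -> : \sum_i xm 0 i * g i xm = 0.
  by rewrite big1 // => i _; case: (gh i) => -> _; rewrite mulr0.
by rewrite mulr0 mul0r addr0; apply: sumr_ge0 => i _; case: (gh i).
Qed.

Definition shell y (a b : R) : set 'rV[R]_d := [set x | a <= sqn (x - y) <= b].

(** Passes from Euclidean to sup-norm bounds, through [t <= t^2 + 1/4]. *)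
Lemma norm_le_sqn x : `|x| <= 1 + sqn x.
Proof.
rewrite [leLHS]/Num.norm /= mx_normrE; apply/bigmax_leP; split.
  by rewrite addr_ge0 // sqn_ge0.
move=> [i j] _ /=; rewrite ord1; have := le_sqn x j.
have : 0 <= (`|x 0 j| - 1 / 2) ^+ 2 by exact: sqr_ge0.
have : `|x 0 j| ^+ 2 = x 0 j ^+ 2 by rewrite real_normK ?num_real.
by move: (`|x 0 j|) (x 0 j) (sqn x) => p q r; nra.
Qed.

Lemma compact_shell y (a b : R) : compact (shell y a b).
Proof.
apply: bounded_closed_compact.
  exists (1 + b + `|y|); split; first exact: num_real.
  move=> M bM x /andP[_ xb]; apply: le_trans (ltW bM).
  rewrite -[x](subrK y); apply: le_trans (ler_normD _ _) _.
  by rewrite lerD2r; apply: le_trans (norm_le_sqn _) _; rewrite lerD2l.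
rewrite (_ : shell y a b = (fun x => sqn (x - y)) @^-1` [set t | a <= t <= b]) //.
apply: preimage_closed; first by move=> x _; exact: continuous_sqnB.
rewrite (_ : [set t | _] = [set t | a <= t] `&` [set t | t <= b]).
  by apply: closedI; [exact: closed_ge|exact: closed_le].
by apply/seteqP; split=> t /= => [/andP|[-> ->]].
Qed.

Lemma interior_shell y (a b : R) x : a < sqn (x - y) < b -> (shell y a b)^° x.
Proof.
move=> /andP[ax xb].
have sc : sqn (z - y) @[z --> x] --> sqn (x - y) by exact: continuous_sqnB.
have h1 : \forall z \near x, a < sqn (z - y).
  exact: (cvgr_gt _ sc _ ax).
have h2 : \forall z \near x, sqn (z - y) < b.
  exact: (cvgr_lt _ sc _ xb).
apply: filterS2 h1 h2 => z az zb.
by rewrite /shell /= !ltW.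
Qed.

Lemma second_partials_radial (F F1 F2 : R -> R) :
  (forall t : R, 0 < t -> is_derive t 1 F (F1 t)) ->
  (forall t : R, 0 < t -> is_derive t 1 F1 (F2 t)) ->
  second_partials (fun x => F (sqn x)) (fun i x => F1 (sqn x) * (2 * x 0 i))
    (fun i x => F2 (sqn x) * (2 * x 0 i) * (2 * x 0 i) + F1 (sqn x) * 2).
Proof.
move=> dF dF1 i x x0; have s0 : 0 < sqn x by rewrite sqn_gt0.
split; first exact: is_derive_comp (is_derive_sqn x i) (dF _ s0).
apply: is_derive_mul; first exact: is_derive_comp (is_derive_sqn x i) (dF1 _ s0).
have := scaled_is_derive 2 (is_derive_coord x (basis_vec i) i).
by rewrite mxE !eqxx mulr1.
Qed.

(** The drift cancels the dimension: with [t = |x|^2] the result is [4 (t F'(t))'], which vanishes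
    for [F = ln]. *)
Lemma drift_laplacian_radial (F1 F2 : R -> R) x : x != 0 ->
  drift_laplacian (fun i x => F1 (sqn x) * (2 * x 0 i))
    (fun i x => F2 (sqn x) * (2 * x 0 i) * (2 * x 0 i) + F1 (sqn x) * 2) x =
  4 * F1 (sqn x) + 4 * sqn x * F2 (sqn x).
Proof.
move=> x0; have sn0 : sqn x != 0 by rewrite sqn_eq0.
rewrite /drift_laplacian big_split /=.
have -> : \sum_(i < d) F1 (sqn x) * 2 = d%:R * (F1 (sqn x) * 2).
  by rewrite sumr_const card_ord mulr_natl.
have -> : \sum_i F2 (sqn x) * (2 * x 0 i) * (2 * x 0 i) =
    sqn x * (4 * F2 (sqn x)).
  by rewrite mulr_suml; apply: eq_bigr => i _; ring.
have -> : \sum_i x 0 i * (F1 (sqn x) * (2 * x 0 i)) = sqn x * (2 * F1 (sqn x)).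
  by rewrite mulr_suml; apply: eq_bigr => i _; ring.
by field.
Qed.

Lemma annulus_comparison w g h (a b A B : R) :
  (forall x, x != 0 -> {for x, continuous w}) -> second_partials w g h ->
  (forall x, x != 0 -> drift_laplacian g h x <= 0) -> 0 < a -> a < b ->
  (forall x, sqn x = a -> A + B * ln a <= w x) ->
  (forall x, sqn x = b -> A + B * ln b <= w x) ->
  forall x, a <= sqn x <= b -> A + B * ln (sqn x) <= w x.
Proof.
move=> wc wgh Lw a0 ab wa wb x xab; apply/ler_addgt0Pr => e e0.
(* The operator kills [A + B ln t], and the added [c (t - b)] contributes [4 c > 0], which makes [F]
   a strict subsolution. This term is at most [0] on the annulus, and with this [c] it costs at most
   [e]. *)
pose c := e / (b - a); have ba0 : 0 < b - a by rewrite subr_gt0.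
have c0 : 0 < c by exact: divr_gt0.
pose F (t : R) := A + B * ln t + c * (t - b).
pose F1 (t : R) := B / t + c.
pose F2 (t : R) := - B / t ^+ 2.
have dF (t : R) : 0 < t -> is_derive t 1 F (F1 t).
  move=> t0; have dln := is_derive1_ln t0.
  have d1 := is_derive_mul (is_derive_cst B t 1) dln.
  have d2 := is_derive_mul (is_derive_cst c t 1)
    (is_derive_add (is_derive_id t 1) (is_derive_cst (- b) t 1)).
  apply: is_derive_eq (is_derive_add (is_derive_add (is_derive_cst A t 1) d1) d2) _.
  by rewrite /F1 /cst /=; ring.
have dF1 (t : R) : 0 < t -> is_derive t 1 F1 (F2 t).
  move=> t0; have tn0 : t != 0 by rewrite gt_eqF.
  have dV := is_deriveV tn0 (is_derive_id t 1).
  have d1 := is_derive_mul (is_derive_cst B t 1) dV.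
  apply: is_derive_eq (is_derive_add d1 (is_derive_cst c t 1)) _.
  rewrite /F2 /=; rewrite -[_ *: 1]/(_ * 1); field.
  by [].
have SD : shell 0 a b `<=` punctured_space.
  move=> y; rewrite /shell /= subr0 => /andP[ay _].
  by rewrite /punctured_space /= -sqn_gt0 (lt_le_trans a0).
have wF := second_partialsB wgh (second_partials_radial dF dF1).
have Fc y : y != 0 -> {for y, continuous (fun y => w y - F (sqn y))}.
  move=> y0; apply: continuousB; first exact: wc.
  apply: (@continuous_comp _ _ _ (@sqn R d) F); first exact: continuous_sqn.
  have [hF _] : is_derive (sqn y) 1 F (F1 (sqn y)) by apply: dF; rewrite sqn_gt0.
  exact/differentiable_continuous/derivable1_diffP.
have : 0 <= w x - F (sqn x).
  apply: (weak_minimum_principle (@compact_shell 0 a b) SD Fc wF); last first.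
    by rewrite /shell /= subr0.
  move=> y; rewrite {1}/shell /= subr0 => /andP[ay yb].
  have [ya|ya] := eqVneq (sqn y) a.
    left; have := wa y ya; rewrite subr_ge0; apply: le_trans; rewrite /F ya.
    by rewrite gerDl pmulr_rle0 // subr_le0 ltW.
  have [yb'|yb'] := eqVneq (sqn y) b.
    left; have := wb y yb'; rewrite subr_ge0 /F yb'.
    by rewrite subrr mulr0 addr0.
  right; split; first by apply: interior_shell; rewrite subr0 !lt_neqAle ay yb eq_sym ya yb'.
  have y0 : y != 0 by rewrite -sqn_gt0 (lt_le_trans a0).
  rewrite drift_laplacianB drift_laplacian_radial // subr_lt0.
  apply: le_lt_trans (Lw y y0) _; rewrite /F1 /F2.
  have -> : 4 * (B / sqn y + c) + 4 * sqn y * (- B / sqn y ^+ 2) = 4 * c.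
    by field; rewrite sqn_eq0.
  by rewrite mulr_gt0.
rewrite subr_ge0 /F => Fw.
have : c * (b - sqn x) <= e.
  have -> : e = c * (b - a) by rewrite /c divfK // gt_eqF.
  by rewrite ler_pM2l // lerB //; case/andP: xab.
move: Fw; move: (ln _) (w x) => l u.
by rewrite !mulrBr; lra.
Qed.

End MinimumPrinciples.

(** * Positive supersolutions are constant *)

Section Liouville.
Context {R : realType} {d : nat}.
Context (w : 'rV[R]_d -> R) (g h : 'I_d -> 'rV[R]_d -> R).
Context (w_continuous : forall x, x != 0 -> {for x, continuous w}).
Context (w_partials : second_partials w g h).
Context (w_super : forall x, x != 0 -> drift_laplacian g h x <= 0).
Implicit Types x y z : 'rV[R]_d.

(* Compare with m - eta |ln |x|^2| on annuli whose far end is so distant that this is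
   negative there, then let eta tend to 0. *)
Lemma positive_supersolution_ge_sphere_min (m : R) :
  (forall x, x != 0 -> 0 < w x) -> 0 < m ->
  (forall x, sqn x = 1 -> m <= w x) -> forall x, x != 0 -> m <= w x.
Proof.
move=> w0 m0 wm x x0; have s0 : 0 < sqn x by rewrite sqn_gt0.
have sphere_neq0 (a : R) y : 0 < a -> sqn y = a -> y != 0.
  by move=> a0 ya; rewrite -sqn_gt0 ya.
apply/ler_addgt0Pr => e e0.
(* Chosen so that the logarithmic loss at the given [x] is at most [e]. *)
pose eta := e / (1 + `|ln (sqn x)|).
have l0 : 0 < 1 + `|ln (sqn x)| by rewrite ltr_pwDl.
have eta0 : 0 < eta by exact: divr_gt0.
have eta_le : eta * `|ln (sqn x)| <= e.
  have -> : e = eta * (1 + `|ln (sqn x)|) by rewrite /eta divfK // gt_eqF.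
  by rewrite ler_pM2l // lerDr.
have me0 : 0 < m / eta by exact: divr_gt0.
have em : eta * (m / eta) = m by rewrite mulrC divfK // gt_eqF.
have [s1|s1] := leP 1 (sqn x).
  have ln0 : 0 <= ln (sqn x) by rewrite ln_ge0.
  (* Far enough out: [m - eta ln b = - eta ln |x|^2 <= 0], which positivity of [w] beats. *)
  pose b := sqn x * expR (m / eta).
  have b1 : 1 < b.
    by rewrite /b (lt_le_trans (_ : 1 < expR (m / eta))) ?expR_gt1 // ler_peMl ?expR_ge0.
  have xb : 1 <= sqn x <= b.
    by rewrite s1 /b ler_peMr ?(ltW s0) // ltW // expR_gt1.
  have lnb : ln b = ln (sqn x) + m / eta.
    by rewrite /b lnM ?posrE ?expR_gt0 // expRK.
  have := annulus_comparison w_continuous w_partials w_super (A := m) (B := - eta) ltr01 b1.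
  move=> /(_ _ _ x xb); rewrite ger0_norm // in eta_le => H.
  suff : m + - eta * ln (sqn x) <= w x by move: eta_le; rewrite mulNr; lra.
  apply: H => y yb; first by rewrite ln1 mulr0 addr0 wm.
  have b0 := lt_trans ltr01 b1.
  apply: ltW; apply: le_lt_trans (w0 y (sphere_neq0 _ _ b0 yb)).
  rewrite lnb mulNr mulrDr em; have : 0 <= eta * ln (sqn x) by rewrite mulr_ge0 // ltW.
  by lra.
have ln0 : ln (sqn x) <= 0 by rewrite ln_le0 // ltW.
(* The mirror choice towards the origin: [m + eta ln a = eta ln |x|^2 <= 0]. *)
pose a := sqn x * expR (- (m / eta)).
have a0 : 0 < a by rewrite mulr_gt0 // expR_gt0.
have ax : a <= sqn x by rewrite /a ler_piMr ?(ltW s0) // -expR0 ler_expR oppr_le0 ltW.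
have xb : a <= sqn x <= 1 by rewrite ax ltW.
have lna : ln a = ln (sqn x) - m / eta.
  by rewrite /a lnM ?posrE ?expR_gt0 // expRK.
have := annulus_comparison w_continuous w_partials w_super (A := m) (B := eta) a0
  (le_lt_trans ax s1).
move=> /(_ _ _ x xb); rewrite ler0_norm // in eta_le => H.
suff : m + eta * ln (sqn x) <= w x by move: eta_le; rewrite mulrN; lra.
apply: H => y yb; last by rewrite ln1 mulr0 addr0 wm.
apply: ltW; apply: le_lt_trans (w0 y (sphere_neq0 _ _ a0 yb)).
rewrite lna mulrBr em; have : eta * ln (sqn x) <= 0 by rewrite mulr_ge0_le0 // ltW.
by lra.
Qed.

Let bump (k : R) y x : R := expR (- k * sqn (x - y)).

Let dbump (k : R) y (i : 'I_d) x : R := - (2 * k) * ((x 0 i - y 0 i) * bump k y x).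

Let ddbump (k : R) y (i : 'I_d) x : R :=
  (4 * k ^+ 2 * (x 0 i - y 0 i) ^+ 2 - 2 * k) * bump k y x.

Let is_derive_bump k y (i : 'I_d) x :
  is_derive x (basis_vec i) (bump k y) (dbump k y i x).
Proof.
have H := is_derive_comp (scaled_is_derive (- k) (is_derive_sqnB y x i))
  (is_derive_expR (- k * sqn (x - y))).
by apply: is_derive_eq H _; rewrite /dbump /bump; ring.
Qed.

Let is_derive_dbump k y (i : 'I_d) x :
  is_derive x (basis_vec i) (dbump k y i) (ddbump k y i x).
Proof.
have dc := is_derive_add (is_derive_coord x (basis_vec i) i)
  (is_derive_cst (- y 0 i) x (basis_vec i)).
have H := scaled_is_derive (- (2 * k)) (is_derive_mul dc (is_derive_bump k y i x)).
apply: is_derive_eq H _.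
by rewrite /ddbump /dbump mxE !eqxx /= mulr1n /cst; ring.
Qed.

(** Factored so that, for [k > 0], the sign is that of the last factor, in which [2 k |x-y|^2] must
    beat a term independent of [k]. *)
Let drift_laplacian_bump k y x : x != 0 ->
  drift_laplacian (dbump k y) (ddbump k y) x =
  bump k y x * (2 * k) * (2 * k * sqn (x - y) -
    (d%:R + (2 - d%:R) * dot x (x - y) / sqn x)).
Proof.
move=> x0; rewrite /drift_laplacian.
have -> : \sum_i ddbump k y i x =
    bump k y x * (4 * k ^+ 2 * sqn (x - y) - d%:R * (2 * k)).
  have -> : d%:R * (2 * k) = \sum_(i < d) (2 * k) by rewrite sumr_const card_ord mulr_natl.
  rewrite mulr_sumr -sumrB mulr_sumr; apply: eq_bigr => i _.
  by rewrite /ddbump !mxE; ring.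
have -> : \sum_i x 0 i * dbump k y i x = - (2 * k) * bump k y x * dot x (x - y).
  rewrite mulr_sumr; apply: eq_bigr => i _.
  by rewrite /dbump !mxE; ring.
by field; rewrite sqn_eq0.
Qed.

(* Hopf's barrier exp(-k |x-y|^2) on a shell around [y]. *)
Lemma strong_minimum_ball (m : R) y z : (2 <= d)%N ->
  (forall x, x != 0 -> m <= w x) -> y != 0 -> m < w y ->
  sqn (z - y) < sqn y -> m < w z.
Proof.
move=> d2 wm y0 wy zy.
pose mid := (m + w y) / 2.
have [r0 r00 near_y] : exists2 r0 : R, 0 < r0 & forall x, sqn (x - y) <= r0 -> mid < w x.
  have mw : mid < w y by rewrite /mid; lra.
  have : \forall x \near y, mid < w x.
    have wc : w x @[x --> y] --> w y by exact: w_continuous.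
    exact: (cvgr_gt _ wc _ mw).
  (* The [ball] is coordinatewise; a squared Euclidean distance at most [(e/2)^2] bounds each
     coordinate by [e/2]. *)
  move=> /nbhs_ballP[e /= e0 He]; exists ((e / 2) ^+ 2).
    by rewrite exprn_gt0 // divr_gt0.
  move=> x xy; apply: He; split=> // i j; rewrite ord1 /ball /=.
  have : `|(x - y) 0 j| <= e / 2.
    by rewrite -ler_sqr ?nnegrE ?divr_ge0 ?(ltW e0) // real_normK ?num_real //;
      apply: le_trans xy; exact: le_sqn.
  by rewrite !mxE distrC; lra.
have mmid : m < mid by rewrite /mid; lra.
have [zr|zr] := leP (sqn (z - y)) r0; first exact: lt_trans (near_y z zr).
(* A squared radius strictly between those of [z] and of the origin, so the shell contains [z] in
   its interior and avoids [0]. *)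
pose r1 := (sqn (z - y) + sqn y) / 2.
have zr1 : sqn (z - y) < r1 by rewrite /r1; lra.
have r1y : r1 < sqn y by rewrite /r1; lra.
have SD : shell y r0 r1 `<=` punctured_space.
  by move=> x /andP[_ xr]; apply: near_neq0 (le_lt_trans xr r1y).
have Sz : shell y r0 r1 z by apply/andP; split; exact: ltW.
have cs : {within shell y r0 r1, continuous (@sqn R d)}.
  by apply: continuous_subspaceT; exact: continuous_sqn.
have [xm] := EVT_min_rV (ex_intro _ z Sz) (@compact_shell R d y r0 r1) cs.
rewrite inE => Sxm xmin; have a0 : 0 < sqn xm by rewrite sqn_gt0; exact: SD.
(* Bounds the term independent of [k], from [2 <x, x-y> = |x|^2 + |x-y|^2 - |y|^2 >= - |y|^2] and
   [|x| >= |xm|] on the shell. *)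
pose M : R := d%:R + (d%:R - 2) / 2 * (sqn y / sqn xm).
have d2R : (2 : R) <= d%:R by rewrite ler_nat.
have M0 : 0 < M.
  rewrite ltr_wpDr ?ltr0n ?(ltnW d2) // !mulr_ge0 ?invr_ge0 ?sqn_ge0 //; lra.
have driftM x : shell y r0 r1 x ->
    d%:R + (2 - d%:R) * dot x (x - y) / sqn x <= M.
  move=> Sx; have sx : 0 < sqn x by rewrite sqn_gt0; exact: SD.
  have xmx : sqn xm <= sqn x by apply: xmin; rewrite inE.
  have hdot : - sqn y / 2 <= dot x (x - y).
    have := sqn_ge0 (x - y); have := sqn_ge0 x.
    by rewrite sqnB dotDr dotNr dotxx; lra.
  rewrite /M lerD2l -[_ * _ / _]mulrA -[2 - _]opprB mulNr -mulrN -mulrA.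
  rewrite ler_wpM2l ?subr_ge0 //.
  apply: (@le_trans _ _ (2^-1 * (sqn y / sqn x))).
    rewrite -mulNr mulrA ler_wpM2r ?invr_ge0 ?sqn_ge0 //; lra.
  by rewrite ler_wpM2l ?invr_ge0 // ler_wpM2l ?sqn_ge0 // lef_pV2.
(* On the shell [|x-y|^2 >= r0], so [2 k |x-y|^2 >= 2 M > M], and the barrier is a strict
   subsolution. *)
pose k := M / r0; have k0 : 0 < k by exact: divr_gt0.
have kr0 : k * r0 = M by rewrite /k divfK // gt_eqF.
pose delta := mid - m; have delta0 : 0 < delta by rewrite subr_gt0.
pose C := expR (- k * r1).
(* Equal to [m] on the outer sphere and at most [m + delta = mid] on the inner one, where [w]
   exceeds [mid]; strictly above [m] at [z]. *)
pose phi x := m + delta * (bump k y x - C).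
have phiD : second_partials phi (fun i x => delta * dbump k y i x)
    (fun i x => delta * ddbump k y i x).
  move=> i x _; split; last by apply: scaled_is_derive; exact: is_derive_dbump.
  have H := is_derive_add (is_derive_bump k y i x) (is_derive_cst (- C) x (basis_vec i)).
  have := is_derive_add (is_derive_cst m x (basis_vec i)) (scaled_is_derive delta H).
  by move=> H'; apply: is_derive_eq H' _; rewrite add0r addr0.
have wphi := second_partialsB w_partials phiD.
have fc x : x != 0 -> {for x, continuous (fun x => w x - phi x)}.
  move=> x0; apply: continuousB; first exact: w_continuous.
  apply: continuousD; first exact: cst_continuous.
  apply: scaled_continuous; apply: continuousB; last exact: cst_continuous.
  apply: (@continuous_comp _ _ _ (fun x => - k * sqn (x - y)) expR).
    by apply: scaled_continuous; exact: continuous_sqnB.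
  exact: continuous_expR.
have phi_lap x : x != 0 ->
    drift_laplacian (fun i x => delta * dbump k y i x) (fun i x => delta * ddbump k y i x) x
    = delta * drift_laplacian (dbump k y) (ddbump k y) x.
  move=> x0; rewrite /drift_laplacian -mulr_sumr.
  have -> : \sum_i x 0 i * (delta * dbump k y i x) = delta * \sum_i x 0 i * dbump k y i x.
    by rewrite mulr_sumr; apply: eq_bigr => i _; ring.
  by ring.
have : 0 <= w z - phi z.
  apply: (weak_minimum_principle (@compact_shell R d y r0 r1) SD fc wphi) => // x Sx.
  have x0 := SD _ Sx; have /andP[xr0 xr1] := Sx.
  have [xr|xr] := eqVneq (sqn (x - y)) r1.
    by left; rewrite /phi /bump /C xr subrr mulr0 addr0 subr_ge0 wm.
  have [xr'|xr'] := eqVneq (sqn (x - y)) r0.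
    left; rewrite subr_ge0 /phi; have := near_y x; rewrite xr' lexx => /(_ isT) /ltW.
    apply: le_trans; rewrite -lerBrDl -/delta ler_piMr ?(ltW delta0) //.
    apply: (@le_trans _ _ (bump k y x)); first by rewrite gerBl expR_ge0.
    by rewrite /bump -expR0 ler_expR mulNr oppr_le0 mulr_ge0 ?sqn_ge0 ?ltW.
  right; split.
    by apply: interior_shell; rewrite !lt_neqAle xr0 xr1 eq_sym xr xr'.
  rewrite drift_laplacianB phi_lap // subr_lt0.
  apply: le_lt_trans (w_super x0) _; rewrite mulr_gt0 // drift_laplacian_bump //.
  apply: mulr_gt0; first by rewrite mulr_gt0 ?expR_gt0 // mulr_gt0.
  rewrite subr_gt0.
  apply: le_lt_trans (driftM x Sx) _; rewrite -kr0.
  have : k * r0 <= k * sqn (x - y) by rewrite ler_pM2l.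
  have : 0 < k * r0 by rewrite kr0.
  by lra.
rewrite subr_ge0; apply: lt_le_trans; rewrite /phi ltrDl mulr_gt0 // subr_gt0.
by rewrite /bump ltr_expR !mulNr ltrN2 ltr_pM2l.
Qed.

Lemma positive_supersolution_constant : (2 <= d)%N ->
  (forall x, x != 0 -> 0 < w x) -> exists c, forall x, x != 0 -> w x = c.
Proof.
move=> d2 w0.
pose e : 'rV[R]_d := basis_vec (Ordinal (ltnW d2)).
have e1 : sqn e = 1 := sqn_basis_vec _.
have Se : shell 0 1 1 e by rewrite /shell /= subr0 e1 lexx.
have SD : shell 0 1 1 `<=` @punctured_space R d.
  move=> y; rewrite /shell /= subr0 => /andP[y1 _].
  by rewrite /punctured_space /= -sqn_gt0 (lt_le_trans ltr01).
have cw : {within shell 0 1 1, continuous w}.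
  by apply: continuous_in_subspaceT => y; rewrite inE => /SD; exact: w_continuous.
have [x1] := EVT_min_rV (ex_intro _ e Se) (@compact_shell R d 0 1 1) cw.
rewrite inE => Sx1 x1min; have x10 := SD _ Sx1.
have wm : forall x, x != 0 -> w x1 <= w x.
  apply: positive_supersolution_ge_sphere_min => //; first exact: w0.
  by move=> x x_1; apply: x1min; rewrite inE /shell /= subr0 x_1 lexx.
exists (w x1) => x x0; apply/eqP; rewrite eq_le wm // andbT leNgt; apply/negP => wx.
suff : w x1 < w x1 by rewrite ltxx.
(* Strictness spreads from [x] to every point, the minimizer [x1] included. *)
apply: (ball_propagation (P := fun x => w x1 < w x) d2 _ x0 x10 wx) => y z y0 wy zy.
exact: strong_minimum_ball zy.
Qed.

End Liouville.

(** * Admissibility and relative invariance *)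

Section Admissibility.
Context {R : realType} {d : nat}.
Implicit Types (x y : 'rV[R]_d) (p q : 'rV[R]_d -> R).

Lemma second_partialsM (f f' : 'rV[R]_d -> R) (g h g' h' : 'I_d -> 'rV[R]_d -> R) :
  second_partials f g h -> second_partials f' g' h' ->
  second_partials (fun x => f x * f' x) (fun i x => g i x * f' x + f x * g' i x)
    (fun i x => (h i x * f' x + g i x * g' i x) + (g i x * g' i x + f x * h' i x)).
Proof.
move=> H H' i x x0; have [? ?] := H i x x0; have [? ?] := H' i x x0.
by split; [exact: is_derive_mul|apply: is_derive_add; exact: is_derive_mul].
Qed.

Lemma second_partials_sqnpow (a : R) :
  second_partials (@sqnpow R d a) (fun i x => 2 * a * (x 0 i * sqnpow (a - 1) x))
    (fun i x => 2 * a * dcoord_sqnpow (a - 1) i i x).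
Proof.
move=> i x x0; split; first exact: is_derive_sqnpow.
by apply: scaled_is_derive; exact: is_derive_coord_sqnpow.
Qed.

(** Written as the power [1/2], the square root can be differentiated twice by the same rule. *)
Lemma second_partials_sqrt p : Ck_on 2 punctured_space p ->
  (forall x, x != 0 -> 0 < p x) -> exists g h,
  second_partials (fun x => p x `^ (2^-1)) g h.
Proof.
move=> p2 p0.
exists (fun i x => 2^-1 * p x `^ (2^-1 - 1) * partial i p x).
exists (fun i x => 2^-1 * ((2^-1 - 1) * p x `^ (2^-1 - 1 - 1) * partial i p x) * partial i p x
  + 2^-1 * p x `^ (2^-1 - 1) * partial i (partial i p) x) => i x x0.
have dp := Ck_on_is_derive i p2 x0.
have ddp := Ck_on_is_derive i (Ck_on_partial i p2) x0.
split; first exact: is_derive_comp dp (is_derive1_powR _ (p0 x x0)).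
apply: is_derive_mul => //; apply: scaled_is_derive.
exact: is_derive_comp dp (is_derive1_powR _ (p0 x x0)).
Qed.

(* The ground state substitution v = |x|^((2-d)/2) w, where w is the product below. *)
Lemma drift_laplacian_ground_state (v : 'rV[R]_d -> R) (g h : 'I_d -> 'rV[R]_d -> R) x
    (a := (d%:R - 2) / 4 : R) : x != 0 ->
  drift_laplacian
    (fun i x => g i x * sqnpow a x + v x * (2 * a * (x 0 i * sqnpow (a - 1) x)))
    (fun i x => (h i x * sqnpow a x + g i x * (2 * a * (x 0 i * sqnpow (a - 1) x))) +
      (g i x * (2 * a * (x 0 i * sqnpow (a - 1) x)) +
       v x * (2 * a * dcoord_sqnpow (a - 1) i i x))) x =
  sqnpow a x * (\sum_i h i x + 4 * a ^+ 2 * v x / sqn x).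
Proof.
move=> x0; rewrite /drift_laplacian !big_split /= -!mulr_suml.
rewrite -!mulr_sumr sum_dcoord_sqnpow // sqnpowB1 //.
have -> : \sum_i g i x * (2 * a * (x 0 i * (sqnpow a x / sqn x))) =
    (\sum_i x 0 i * g i x) * (2 * a * sqnpow a x / sqn x).
  by rewrite mulr_suml; apply: eq_bigr => i _; ring.
have -> : \sum_i x 0 i * (g i x * sqnpow a x + v x * (2 * a * (x 0 i * (sqnpow a x / sqn x)))) =
    (\sum_i x 0 i * g i x) * sqnpow a x + sqn x * (v x * (2 * a * sqnpow a x / sqn x)).
  rewrite mulr_suml [sqn x * _]mulr_suml -big_split.
  by apply: eq_bigr => i _ /=; ring.
have sn0 : sqn x != 0 by rewrite sqn_eq0.
have -> : d%:R = 4 * a + 2 :> R by rewrite /a; field.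
by clearbody a; field.
Qed.

Lemma admissible_power_form (alpha c : R) p : (2 <= d)%N -> 0 < alpha -> alpha <= 1 ->
  0 < c -> power_form c (2 - d%:R) p ->
  admissible alpha punctured_space identity_cov p.
Proof.
move=> d2 a0 a1 c0 pE; split; first exact: (prior_power_form a0 a1 c0 pE).
move=> [q [[[q2 _] q0] qp riskq]]; apply: qp.
have [g [h vgh]] := second_partials_sqrt q2 q0.
set v := (fun x => _) in vgh.
pose a : R := (d%:R - 2) / 4.
have v0 x : x != 0 -> 0 < v x by move=> x0; rewrite powR_gt0 // q0.
(* The risk of [|x|^(2-d)] is [- (d-2)^2 / (2 |x|^2)], that of [q] is [2 Lap v / v], and
   [4 a^2 = (d-2)^2 / 4]. *)
have h_le x : x != 0 -> \sum_i h i x + 4 * a ^+ 2 * v x / sqn x <= 0.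
  move=> x0; have s0 : 0 < sqn x by rewrite sqn_gt0.
  have vx := v0 x x0.
  have riskv : risk identity_cov q x = 2 / v x * \sum_i h i x.
    apply: (risk_identity_cov (g := g)) => // [y y0|i y y0|i y y0].
    - by rewrite -powR12_sqrt // ltW // q0.
    - by case: (vgh i y y0).
    - by case: (vgh i y y0).
  have := riskq x x0; rewrite riskv (risk_power_form c0 pE x0).
  have -> : (2 - d%:R) * (d%:R + (2 - d%:R) / 2 - 2) / sqn x =
      2 / v x * (- (4 * a ^+ 2 * v x / sqn x)) :> R.
    by rewrite /a; field; rewrite !gt_eqF.
  by rewrite ler_pM2l ?divr_gt0 // -subr_le0 opprK.
have wgh := second_partialsM vgh (second_partials_sqnpow a).
have [k wk] : exists k, forall x, x != 0 -> v x * sqnpow a x = k.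
  apply: (positive_supersolution_constant _ wgh) => // [x x0|x x0|x x0].
  - apply: continuousM; last exact: continuous_sqnpow.
    have [hd _] := is_derive1_powR 2^-1 (q0 x x0).
    apply: (@continuous_comp _ _ _ q (fun t => t `^ 2^-1)).
      exact: Ck_on_continuous q2 x0.
    exact/differentiable_continuous/derivable1_diffP.
  - by rewrite drift_laplacian_ground_state // pmulr_rle0 ?sqnpow_gt0 //; exact: h_le.
  - by rewrite mulr_gt0 ?v0 // sqnpow_gt0.
(* From [v |x|^(2a) = k] follows [q = v^2 = k^2 |x|^(-4a) = k^2 |x|^(2-d)]. *)
exists (k ^+ 2 / c) => x x0; rewrite pE // euclid_norm_powR.
have sP := sqnpow_gt0 a x0.
have -> : q x = v x ^+ 2.
  by rewrite /v powR12_sqrt ?sqr_sqrtr // ltW // q0.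
have -> : (2 - d%:R) / 2 = - (a + a) by rewrite /a; field.
rewrite /sqnpow powRN -/(sqnpow _ x) sqnpowD // -(wk x x0).
by field; rewrite !gt_eqF.
Qed.

Lemma not_admissible_power_form (alpha c b : R) p : (2 <= d)%N -> 0 < alpha -> alpha <= 1 ->
  0 < c -> power_form c b p -> admissible alpha punctured_space identity_cov p ->
  b = 2 - d%:R.
Proof.
move=> d2 a0 a1 c0 pE [_ pmin]; apply/eqP/negP => /negP bd; apply: pmin.
pose q x := 1 * euclid_norm x `^ (2 - d%:R) : R.
have qE : power_form 1 (2 - d%:R) q by [].
exists q; split; first exact: (prior_power_form a0 a1 ltr01 qE).
(* Proportionality is refuted at [e] and [2 e]: the first gives [k c = 1], and the logarithm of the
   second then equates the exponents. *)
- move=> [k qkp].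
  pose e : 'rV[R]_d := basis_vec (Ordinal (ltnW d2)).
  have e1 : sqn e = 1 := sqn_basis_vec _.
  have e0 : e != 0 by rewrite -sqn_gt0 e1.
  have e20 : 2 *: e != 0 by rewrite scaler_eq0 negb_or e0 pnatr_eq0.
  have := qkp e e0; rewrite pE // qE // !euclid_norm_powR /sqnpow e1 !powR1.
  rewrite !mulr1 => kc; have := qkp _ e20.
  rewrite pE // qE // mulrA -kc !mul1r !euclid_norm_powR /sqnpow sqnZ e1 mulr1.
  move=> /(congr1 (@ln R)); rewrite !ln_powR => /mulIf E.
  have ln4 : ln (2 ^+ 2) != 0 :> R by rewrite gt_eqF // ln_gt0 //; lra.
  by have := E ln4; move: bd => /eqP bd; lra.
move=> x x0; rewrite (risk_power_form ltr01 qE x0) (risk_power_form c0 pE x0).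
rewrite ler_pM2r ?invr_gt0 ?sqn_gt0 //.
have : 0 <= (b + d%:R - 2) ^+ 2 by exact: sqr_ge0.
by move: (d%:R) => n; nra.
Qed.

End Admissibility.

Section RelativeInvariance.
Context {R : realType} {d : nat}.
Implicit Types (x y : 'rV[R]_d) (p q : 'rV[R]_d -> R).

Lemma relatively_invariant_power_form (alpha c b : R) p : (2 <= d)%N ->
  0 < alpha -> alpha <= 1 -> 0 < c -> power_form c b p ->
  relatively_invariant alpha punctured_space identity_cov p.
Proof.
move=> d2 a0 a1 c0 pE; split; first exact: (prior_power_form a0 a1 c0 pE).
move=> T TT; have [A [C [C0 AA TE]]] := covariance_scalingP d2 TT.
exists (C `^ (b / 2) * `|\det A|) => x x0.
have [-> TxE] := TE x x0; have [_ [Tfun _ _] _] := TT.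
rewrite pE; last exact: Tfun.
rewrite pE // TxE !euclid_norm_powR /sqnpow (sqn_conformal _ _ AA) ?gt_eqF //.
by rewrite powRM ?sqn_ge0 ?(ltW C0) //; ring.
Qed.

Lemma mulmx_row_outer x v : x *m (v^T *m v) = dot x v *: v.
Proof.
rewrite mulmxA; apply/rowP => i; rewrite !mxE big_ord1 !mxE; congr (_ * _).
by apply: eq_bigr => j _; rewrite !mxE.
Qed.

Definition householder v : 'M[R]_d := 1%:M - (2 / sqn v) *: (v^T *m v).

Lemma householder_tr v : (householder v)^T = householder v.
Proof. by rewrite /householder raddfB /= trmx1 linearZ /= trmx_mul trmxK. Qed.

Lemma mulmx_householder x v : x *m householder v = x - (2 / sqn v * dot x v) *: v.
Proof.
by rewrite mulmxBr mulmx1 -scalemxAr mulmx_row_outer scalerA.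
Qed.

Lemma householderK v : v != 0 -> householder v *m householder v = 1%:M.
Proof.
move=> v0; apply/row_matrixP => i; rewrite row_mul row1; set u : 'rV_d := row i _.
have -> : u = delta_mx 0 i *m householder v by rewrite -rowE.
set e : 'rV_d := delta_mx 0 i.
rewrite !mulmx_householder dotDl dotNl dotZl dotxx.
have -> : 2 / sqn v * (dot e v - 2 / sqn v * dot e v * sqn v) =
    - (2 / sqn v * dot e v).
  by field; rewrite sqn_eq0.
by rewrite scaleNr opprK subrK.
Qed.

(** For vectors of equal length [2 <x, x-y> = |x-y|^2], so the reflection subtracts exactly
    [x - y]. *)
Lemma householder_swap x y : sqn x = sqn y -> x != y -> x *m householder (x - y) = y.
Proof.
move=> xy nxy; have v0 : x - y != 0 by rewrite subr_eq0.
rewrite mulmx_householder.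
have -> : 2 / sqn (x - y) * dot x (x - y) = 1.
  have := v0; rewrite -sqn_eq0 sqnB -xy dotDr dotNr dotxx => v0'.
  by field.
by rewrite scale1r opprB addrC subrK.
Qed.

Lemma relatively_invariant_linear (alpha : R) p (A : 'M[R]_d) (C : R) :
  relatively_invariant alpha punctured_space identity_cov p ->
  0 < C -> A *m A^T = C%:M ->
  exists c, forall x, x != 0 -> p (x *m A^T) * `|\det A| = c * p x.
Proof.
move=> [_ pinv] C0 AA; have [c Hc] := pinv _ (covariance_scaling_linear C0 AA).
by exists c => x /Hc; rewrite jacobian_linear.
Qed.

(** A reflection exchanging [x] and [y] is used at both points: [p y k = c p x] and [p x k = c p y]
    give [(p x)^2 = (p y)^2], whatever the constant [c]. *)
Lemma relatively_invariant_radial (alpha : R) p :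
  relatively_invariant alpha punctured_space identity_cov p ->
  forall x y, x != 0 -> sqn x = sqn y -> p x = p y.
Proof.
move=> pinv x y x0 xy; have [->//|nxy] := eqVneq x y.
have p0 : forall x, x != 0 -> 0 < p x by case: pinv => -[].
have v0 : x - y != 0 by rewrite subr_eq0.
have y0 : y != 0 by rewrite -sqn_gt0 -xy sqn_gt0.
have HH : householder (x - y) *m (householder (x - y))^T = 1%:M.
  by rewrite householder_tr householderK.
have [c Hc] := relatively_invariant_linear pinv ltr01 HH.
have := Hc x x0; have := Hc y y0; rewrite householder_tr.
have -> : y *m householder (x - y) = x.
  by rewrite -{1}(householder_swap xy nxy) -mulmxA householderK // mulmx1.
rewrite householder_swap //.
have [Hu _] := mulmx1_unit HH; move: Hu; rewrite unitmxE unitfE -normr_gt0.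
move: (`|_|) => k k0 e1 e2.
have px := p0 x x0; have py := p0 y y0.
have : p x ^+ 2 * k = p y ^+ 2 * k.
  by rewrite !expr2 -!mulrA e1 e2; ring.
move=> /(mulIf (lt0r_neq0 k0)) /eqP; rewrite eqrXn2 ?ltW // => /eqP //.
Qed.

(* In the variable s = ln |x| the invariance under dilations is an affine Cauchy equation. *)
Lemma relatively_invariantP (alpha : R) p : (2 <= d)%N ->
  relatively_invariant alpha punctured_space identity_cov p ->
  exists c b, 0 < c /\ power_form c b p.
Proof.
move=> d2 pinv.
have p0 : forall x, x != 0 -> 0 < p x by case: pinv => -[].
pose i0 := Ordinal (ltnW d2); pose e : 'rV[R]_d := basis_vec i0.
have e1 : sqn e = 1 := sqn_basis_vec _.
have e0 : e != 0 by rewrite -sqn_gt0 e1.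
have te0 s : expR s *: e != 0 by rewrite scaler_eq0 negb_or e0 gt_eqF ?expR_gt0.
pose F s := ln (p (expR s *: e)).
(* The unknown constant of the dilation by [expR s] is eliminated by evaluating at both [t] and
   [0]. *)
have FD s t : F (s + t) = F s + (F t - F 0).
  have s0 : expR s != 0 by rewrite gt_eqF ?expR_gt0.
  have AA : (expR s)%:M *m ((expR s)%:M)^T = (expR s ^+ 2)%:M :> 'M[R]_d.
    by rewrite tr_scalar_mx -scalar_mxM expr2.
  have [c Hc] := relatively_invariant_linear pinv (exprn_gt0 2 (expR_gt0 s)) AA.
  have {}Hc u : p (expR (s + u) *: e) * `|\det ((expR s)%:M : 'M[R]_d)| = c * p (expR u *: e).
    by have := Hc _ (te0 u); rewrite tr_scalar_mx mul_mx_scalar scalerA -expRD.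
  have k0 : 0 < `|\det ((expR s)%:M : 'M[R]_d)|.
    by rewrite normr_gt0 det_scalar expf_neq0.
  move: (`|_|) k0 Hc => k k0 Hc.
  have E : p (expR (s + t) *: e) * p (expR 0 *: e) = p (expR s *: e) * p (expR t *: e).
    apply: (mulIf (lt0r_neq0 k0)); have := Hc t; have := Hc 0; rewrite addr0 => h1 h2.
    by rewrite mulrAC h2 [RHS]mulrAC h1; ring.
  have := congr1 (@ln R) E; rewrite !lnM ?posrE ?p0 // -/(F _) -/(F _) -/(F _) -/(F _).
  by move=> h; lra.
have [b Fb] : exists b, is_derive (0 : R) 1 F b.
  have [[p2 _] _] := pinv.1.
  have dp := Ck_on_is_derive i0 p2 e0.
  have dp1 : is_derive (1 : R) 1 (fun t => p (t *: e + 0)) (partial i0 p e).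
    by apply/(@is_derive_line R 'rV[R]_d p 0 e 1); rewrite scale1r addr0.
  have dp2 : is_derive (expR 0) 1 (fun t => p (t *: e)) (partial i0 p e).
    by rewrite expR0; move: dp1; under eq_fun do rewrite addr0.
  have dp3 := is_derive_comp (is_derive_expR (0 : R)) dp2.
  have dp4 := is_derive_comp dp3 (is_derive1_ln (p0 _ (te0 0))).
  by eexists; exact: dp4.
(* The functional equation transports the derivative at [0] to every [t], so [F] is affine with
   slope [b]. *)
have FbD (t : R) : is_derive t 1 F b.
  have H : is_derive (0 : R) 1 (fun s => F (s + t)) b.
    have := is_derive_add Fb (is_derive_cst (F t - F 0) (0 : R) 1); rewrite addr0.
    by rewrite (_ : (fun s => F (s + t)) = (fun s => F s + cst (F t - F 0) s)) //; apply/funext.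
  have : is_derive t 1 (fun u => F (u + - t + t)) b.
    by apply: (@is_derive_translate R R (fun s => F (s + t))); rewrite subrr.
  by under eq_fun do rewrite subrK.
have FE s : F s = b * s + F 0.
  have D0 (t : R) : is_derive t 1 (fun s => F s + - b * s) 0.
    have := is_derive_add (FbD t) (is_derive_mul (is_derive_cst (- b) t 1) (is_derive_id t 1)).
    by move=> H; apply: is_derive_eq H _; rewrite /cst; ring.
  by have := @is_derive_0_is_cst R (fun s => F s + - b * s) s 0 D0; lra.
exists (p e), b; split; first exact: p0.
move=> x x0; have s0 : 0 < euclid_norm x by rewrite sqrtr_gt0 -/(sqn x) sqn_gt0.
have -> : p x = p (expR (ln (euclid_norm x)) *: e).
  apply: (relatively_invariant_radial pinv x0).
  by rewrite sqnZ e1 mulr1 lnK ?posrE // sqr_sqrtr // sqn_ge0.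
have -> : p (expR (ln (euclid_norm x)) *: e) = expR (F (ln (euclid_norm x))).
  by apply/esym/lnK; rewrite posrE p0.
rewrite FE expRD /F expR0 scale1r [X in _ * X]lnK ?posrE ?p0 // mulrC.
by rewrite /powR gt_eqF.
Qed.

End RelativeInvariance.

Theorem mainTheorem6 (R : realType) (d : nat) (alpha : R)
    (hd : (2 <= d)%N) (halpha0 : 0 < alpha) (halpha1 : alpha <= 1) :
  [/\ (forall p : 'rV[R]_d -> R,
         relatively_invariant alpha punctured_space identity_cov p <->
         exists c beta : R, 0 < c /\ power_form c beta p),
      (forall (c beta : R) (p : 'rV[R]_d -> R),
         0 < c -> power_form c beta p ->
         (admissible alpha punctured_space identity_cov p <->
          beta = 2 - d%:R)) &
      (forall p : 'rV[R]_d -> R,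
         (relatively_invariant alpha punctured_space identity_cov p /\
          admissible alpha punctured_space identity_cov p) <->
         exists c : R, 0 < c /\ power_form c (2 - d%:R) p)].
Proof.
have inv (p : 'rV[R]_d -> R) : relatively_invariant alpha punctured_space identity_cov p <->
    exists c beta : R, 0 < c /\ power_form c beta p.
  split; first exact: (relatively_invariantP hd).
  by move=> [c [b [c0 pE]]]; exact: (relatively_invariant_power_form hd halpha0 halpha1 c0 pE).
have adm (c b : R) (p : 'rV[R]_d -> R) : 0 < c -> power_form c b p ->
    admissible alpha punctured_space identity_cov p <-> b = 2 - d%:R.
  move=> c0 pE; split; first exact: (not_admissible_power_form hd halpha0 halpha1 c0 pE).
  by move=> bE; rewrite bE in pE; exact: (admissible_power_form hd halpha0 halpha1 c0 pE).
split=> // p; split=> [[/inv [c [b [c0 pE]]] padm]|[c [c0 pE]]].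
  by exists c; split=> //; rewrite -(iffLR (adm c b p c0 pE) padm).
by split; [apply/inv; exists c, (2 - d%:R)|apply/(adm c _ p c0 pE)].
Qed.
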